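(* Let $a,b>1$ be integers and let $R=\mathbb{C}[x_iy_j : 1\le i\le a,\ 1\le j\le b]\subseteq\mathbb{C}[x_1,\dots,x_a,y_1,\dots,y_b]$ be the coordinate ring of the Segre embedding of $\mathbb{P}^{a-1}\times\mathbb{P}^{b-1}$, $\mathbb{N}$-graded so that each $x_iy_j$ has degree $1$. Then: (1) The ring $D_{R|\mathbb{C}}$ equipped with any Bernstein filtration $\mathcal{B}^\bullet$ is linearly simple. (2) If $M$ is a nonzero left $D_{R|\mathbb{C}}$-module and $\mathcal{F}^\bullet$ is a filtration on $M$ compatible with a Bernstein filtration $\mathcal{B}^\bullet$, then $\operatorname{Dim}(M,\mathcal{F}^\bullet)\ge\dim(R)$. (3) Every nonzero element of $R$ has a nonzero sandwich Bernstein-Sato polynomial.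
   Context: Write $K=\mathbb{C}$. Differential operators: for a commutative $K$-algebra $R$, $D_{R|K}\subseteq \operatorname{End}_K(R)$ is the ring of $K$-linear differential operators: $D^0_{R|K}$ is the set of multiplication operators by elements of $R$ (identified with $R$), $D^{n+1}_{R|K}=\{\delta\in\operatorname{End}_K(R): [\delta,r]\in D^n_{R|K}\text{ for all } r\in R\}$, and $D_{R|K}=\bigcup_n D^n_{R|K}$, with composition as product. The order $\operatorname{ord}(\delta)$ is the least $n$ with $\delta\in D^n_{R|K}$. Bernstein filtration (for $R$ finitely generated $\mathbb{N}$-graded with $R_0=K$): $\delta$ is homogeneous of degree $d$ if $\delta([R]_j)\subseteq [R]_{j+d}$ for all $j$. For an integer $w$ such that $R$ is generated as a $K$-algebra by homogeneous elements of degree strictly less than $w$, the Bernstein filtration with slope $w$ on $D_{R|K}$ is $B^i=K\text{-span}\{\delta\text{ homogeneous}: \deg(\delta)+w\operatorname{ord}(\delta)\le i\}$, $i\ge0$. A Bernstein filtration is one of these for some such $w$. Linear simplicity: a filtered $K$-algebra $(A,\mathcal{F}^\bullet)$ is linearly simple if there is a constant $C$ such that for all $t$ and all $r\in F^t\smallsetminus\{0\}$, $1\in F^{Ct}\,r\,F^{Ct}$ (the $K$-span of the products $\alpha r\beta$, $\alpha,\beta\in F^{Ct}$). Compatible filtration on a left module $M$: an ascending sequence of $K$-subspaces $F^0\subseteq F^1\subseteq\cdots$ with $\bigcup_iF^i=M$ and $B^iF^j\subseteq F^{i+j}$. Dimension: $\operatorname{Dim}(M,\mathcal{F}^\bullet)=\inf\{t\in\mathbb{R}_{\ge0}: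 \lim_{n\to\infty}\dim_K(F^n)/n^t=0\}$ ($\infty$ if there is no such $t$). Sandwich Bernstein-Sato polynomial: a sandwich Bernstein-Sato equation for $f\in R$ consists of finitely many $\alpha_i(s),\beta_i(s)\in D_{R|K}[s]$ and $b(s)\in K[s]$ with $\sum_i \alpha_i(n) f^{n+1}\beta_i(n)=b(n)f^n$ as operators in $D_{R|K}$ (products are compositions) for all $n\in\mathbb{N}=\{0,1,2,\dots\}$. The set of $b(s)$ occurring is an ideal of $K[s]$; the sandwich Bernstein-Sato polynomial of $f$ is its monic generator, or $0$ if the ideal is zero. *)

(* Defs.v *)
From HB Require Import structures.
From mathcomp Require Import all_boot all_order all_algebra.
From mathcomp Require Import ring_quotient.
From mathcomp Require Import all_classical all_reals all_analysis.
From mathcomp Require Import complex.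
From mathcomp Require mpoly.
(* The notations of mpoly clash with those of MathComp-Analysis. *)
Import -(notations) mpoly.

Set Implicit Arguments.
Unset Strict Implicit.
Unset Printing Implicit Defensive.

Import Order.TTheory GRing.Theory Num.Theory.
Import numFieldNormedType.Exports.

Local Open Scope classical_set_scope.
Local Open Scope ring_scope.

Definition kspan (K : fieldType) (V : lmodType K) (S : set V) : set V :=
  [set v | exists n (c : 'I_n -> K) (u : 'I_n -> V),
     (forall i, S (u i)) /\ v = \sum_(i < n) c i *: u i].

(* The K-subalgebra of A generated by S. *)
Definition adjoin (K : fieldType) (A : algType K) (S : set A) : {pred A} :=
  fun x => `[< forall T : {pred A}, GRing.subalg_closed T ->
                 (forall y, S y -> y \in T) -> x \in T >].

Section DiffOp.
Variables (K : fieldType) (R : comAlgType K).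
Implicit Types (d e : R -> R) (r f : R).

Fixpoint diff_le (n : nat) d : Prop :=
  if n is m.+1 then
    linear d /\ forall r, diff_le m (fun f => d (r * f) - r * d f)
  else exists r, d = (fun f => r * f).

Lemma diff_le_linear n d : diff_le n d -> linear d.
Proof.
case: n => [[r ->] k x y|n []] //.
by rewrite mulrDr scalerAr.
Qed.

Lemma diff_le0 n : diff_le n 0.
Proof.
elim: n => [|n IH] /=.
  by exists 0; apply/funext => f; rewrite mul0r.
split; first by move=> k x y /=; rewrite -[LHS]/(0 : R) scaler0 addr0.
move=> r; rewrite (_ : (fun _ => _) = 0) //.
by apply/funext => f; rewrite -[RHS]/(0 : R) -[X in X - _]/(0 : R) add0r
  -[X in - (r * X)]/(0 : R) mulr0 oppr0.
Qed.

Lemma diff_leS n d : diff_le n d -> diff_le n.+1 d.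
Proof.
elim: n d => [|n IH] d.
  case=> r ->; split=> [k x y|s]; first by rewrite mulrDr scalerAr.
  rewrite (_ : (fun _ => _) = 0); first exact: diff_le0.
  by apply/funext => f; rewrite mulrCA subrr.
by case=> ld hd; split=> // r; exact/IH/hd.
Qed.

Lemma diff_le_mono m n d : (m <= n)%N -> diff_le m d -> diff_le n d.
Proof.
move=> /subnKC <-; elim: (n - m)%N => [|k IH]; first by rewrite addn0.
by rewrite addnS => /IH /diff_leS.
Qed.

Lemma diff_le_comb n (k : K) d e : diff_le n d -> diff_le n e ->
  diff_le n (fun f => k *: d f + e f).
Proof.
elim: n d e => [|n IH] d e /=.
  move=> [r ->] [s ->]; exists (k *: r + s).
  by apply/funext => f; rewrite mulrDl scalerAl.
move=> [ld hd] [le he]; split.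
  move=> c x y; rewrite ld le !scalerDr !scalerA [k * c]mulrC -!addrA.
  by congr (_ + _); rewrite addrCA.
move=> r; rewrite (_ : (fun _ => _) =
  (fun f => k *: (d (r * f) - r * d f) + (e (r * f) - r * e f))).
  exact: IH.
apply/funext => f; rewrite mulrDr scalerBr scalerAr opprD -!addrA.
by congr (_ + _); rewrite addrCA.
Qed.

Lemma diff_le_comp m n d e :
  diff_le m d -> diff_le n e -> diff_le (m + n) (d \o e).
Proof.
have lincomp d' e' : linear d' -> linear e' -> linear (d' \o e').
  by move=> ld le k x y /=; rewrite le ld.
have [N] := ubnP (m + n)%N; elim: N m n d e => // N IH m n d e leN hd he.
have ld := diff_le_linear hd; have le := diff_le_linear he.
have ldB x y : d (x - y) = d x - d y.
  by rewrite -[- y]scaleN1r addrC ld scaleN1r addrC.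
have bracket r : (fun f => (d \o e) (r * f) - r * (d \o e) f) =
    (fun f => 1 *: (d \o (fun f => e (r * f) - r * e f)) f +
              ((fun f => d (r * f) - r * d f) \o e) f).
  apply/funext => f /=; rewrite scale1r ldB addrA.
  by congr (_ - _); rewrite -addrA [- _ + _]addrC subrr addr0.
case: m n hd he leN => [|m] [|n] hd he leN.
- case: hd he => [r ->] [s ->]; exists (r * s).
  by apply/funext => f /=; rewrite mulrA.
- split; first exact: lincomp.
  move=> r; rewrite bracket; apply: diff_le_comb.
    by apply: (IH 0%N n) => //; exact: he.2.
  rewrite (_ : _ \o e = 0); first exact: diff_le0.
  case: hd => s ->; apply/funext => f /=.
  by rewrite mulrCA subrr.
- rewrite addn0; split; first exact: lincomp.
  move=> r; rewrite bracket; apply: diff_le_comb.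
    rewrite (_ : d \o _ = 0); first exact: diff_le0.
    case: he => s ->; apply/funext => f /=.
    by rewrite mulrCA subrr -[in LHS](subrr 0) ldB subrr.
  by rewrite -[m]addn0; apply: IH => //; rewrite ?addn0 ?addSn // in leN *;
     exact: hd.2.
- rewrite addSn; split; first exact: lincomp.
  move=> r; rewrite bracket; apply: diff_le_comb.
    rewrite addnS -addSn; apply: IH => //; last exact: he.2.
    by move: leN; rewrite addnS.
  apply: IH => //; last exact: hd.2.
Qed.

Definition diffop_pred : {pred R -> R} := fun d => `[< exists n, diff_le n d >].

Record diffop := DiffOp { diffop_fun :> R -> R; _ : diffop_fun \in diffop_pred }.

HB.instance Definition _ := [isSub for diffop_fun].
HB.instance Definition _ := [Choice of diffop by <:].

Lemma diffop_predP d : reflect (exists n, diff_le n d) (d \in diffop_pred).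
Proof. exact: asboolP. Qed.

Lemma diffop_submod_closed : GRing.submod_closed diffop_pred.
Proof.
split; first by apply/diffop_predP; exists 0%N; exact: diff_le0.
move=> k d e /diffop_predP[m hd] /diffop_predP[n he].
apply/diffop_predP; exists (maxn m n); apply: (@diff_le_comb (maxn m n) k d e).
  exact: diff_le_mono (leq_maxl _ _) hd.
exact: diff_le_mono (leq_maxr _ _) he.
Qed.

HB.instance Definition _ :=
  GRing.isSubmodClosed.Build K (R -> R) diffop_pred diffop_submod_closed.
HB.instance Definition _ := [SubChoice_isSubZmodule of diffop by <:].
HB.instance Definition _ := [SubZmodule_isSubLmodule of diffop by <:].

Lemma diffopP (d : diffop) : exists n, diff_le n d.
Proof. exact/diffop_predP/(valP d). Qed.

Lemma diffop_linear (d : diffop) : linear d.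
Proof. by have [n /diff_le_linear] := diffopP d. Qed.

Lemma mulop_subproof r : (fun f => r * f) \in diffop_pred.
Proof. by apply/diffop_predP; exists 0%N, r. Qed.

Definition mulop r : diffop := DiffOp (mulop_subproof r).

Lemma compop_subproof (d e : diffop) : d \o e \in diffop_pred.
Proof.
have [m hd] := diffopP d; have [n he] := diffopP e.
by apply/diffop_predP; exists (m + n)%N; exact: diff_le_comp.
Qed.

Definition compop (d e : diffop) : diffop := DiffOp (compop_subproof d e).

Lemma diffop_eq (d e : diffop) : (forall f, d f = e f) -> d = e.
Proof. by move=> de; apply/val_inj/funext. Qed.

Let compA : associative compop.
Proof. by move=> d e g; exact: diffop_eq. Qed.

Let comp1l : left_id (mulop 1) compop.
Proof. by move=> d; apply: diffop_eq => f /=; rewrite mul1r. Qed.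

Let comp1r : right_id (mulop 1) compop.
Proof. by move=> d; apply: diffop_eq => f /=; rewrite mul1r. Qed.

Let compDl : left_distributive compop +%R.
Proof. by move=> d e g; exact: diffop_eq. Qed.

Let compDr : right_distributive compop +%R.
Proof.
move=> d e g; apply: diffop_eq => f.
rewrite -[LHS]/(d (e f + g f)) -[e f]scale1r diffop_linear scale1r //.
Qed.

Let op1_neq0 : mulop 1 != 0.
Proof.
apply/eqP => /(congr1 (fun d : diffop => d 1)) /=; rewrite mul1r => /eqP.
by rewrite -[X in _ == X]/(0 : R) oner_eq0.
Qed.

(* The product of diffop is composition. *)
HB.instance Definition _ := GRing.Zmodule_isNzRing.Build diffop
  compA comp1l comp1r compDl compDr op1_neq0.

Let compZl (k : K) (d e : diffop) : k *: (d * e) = (k *: d) * e.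
Proof. exact: diffop_eq. Qed.

HB.instance Definition _ := GRing.Lmodule_isLalgebra.Build K diffop compZl.

Let compZr (k : K) (d e : diffop) : k *: (d * e) = d * (k *: e).
Proof.
apply: diffop_eq => f; rewrite -[LHS]/(k *: d (e f)) -[RHS]/(d (k *: e f)).
have d0 : d 0 = 0.
  have := diffop_linear d 1 0 0; rewrite !scale1r addr0 => /eqP.
  by rewrite -subr_eq subrr eq_sym => /eqP.
by rewrite -[k *: e f]addr0 diffop_linear d0 addr0.
Qed.

HB.instance Definition _ := GRing.Lalgebra_isAlgebra.Build K diffop compZr.

Lemma diffop_asboolP (d : diffop) : exists n, `[< diff_le n d >].
Proof. by have [n hn] := diffopP d; exists n; apply/asboolP. Qed.

Definition diffop_ord (d : diffop) : nat := ex_minn (diffop_asboolP d).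

(* A grading is given by its components gr j for j in nat; the components of
   negative degree are zero. *)
Definition homog_op (gr : nat -> set R) (d : diffop) (k : int) : Prop :=
  forall (j : nat) f, gr j f ->
    if (j%:Z + k)%R is Posz l then gr l (d f) else d f = 0.

Definition bernstein (gr : nat -> set R) (w : int) (i : nat) : set diffop :=
  kspan [set d | exists2 k : int,
           homog_op gr d k & k + w * (diffop_ord d)%:Z <= i%:Z].

Definition bernstein_slope (gr : nat -> set R) (w : int) : Prop :=
  forall f : R, f \in adjoin [set g | exists2 j : nat, gr j g & j%:Z < w].

Definition bernstein_filtration (gr : nat -> set R) (B : nat -> set diffop) :=
  exists2 w : int, bernstein_slope gr w & B = bernstein gr w.

Definition sandwich_eq (f : R) (b : {poly K}) : Prop :=
  exists s : seq ({poly diffop} * {poly diffop}), forall n : nat,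
    \sum_(p <- s) p.1.[n%:R] * mulop (f ^+ n.+1) * p.2.[n%:R] =
    b.[n%:R] *: mulop (f ^+ n).

(* The monic generator of the ideal {b | sandwich_eq f b}, or 0 if this ideal
   is zero; sandwich_bsP shows that the specification is satisfied. *)
Definition sandwich_bs (f : R) : {poly K} :=
  xget 0 [set b | (b = 0 \/ b \is monic) /\
                  forall c, sandwich_eq f c <-> b %| c].

Lemma sandwich_eqD f b c :
  sandwich_eq f b -> sandwich_eq f c -> sandwich_eq f (b + c).
Proof.
move=> [s hs] [t ht]; exists (s ++ t) => n.
by rewrite big_cat /= hs ht hornerD scalerDl.
Qed.

Lemma sandwich_eqM f b c : sandwich_eq f b -> sandwich_eq f (c * b).
Proof.
move=> [s hs]; pose q : {poly diffop} := map_poly (in_alg diffop) c.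
exists [seq (q * p.1, p.2) | p <- s] => n.
have comm (x : diffop) : GRing.comm x n%:R by exact: commr_nat.
have qE : q.[n%:R] = c.[n%:R]%:A.
  by rewrite /q -[n%:R](rmorph_nat (in_alg diffop)) horner_map.
rewrite big_map /= hornerM -scalerA -hs scaler_sumr; apply: eq_bigr => p _.
rewrite hornerM_comm; last exact/commr_sym/comm.
by rewrite qE mulr_algl -!scalerAl.
Qed.

Lemma sandwich_bsP f : (sandwich_bs f = 0 \/ sandwich_bs f \is monic) /\
  forall c, sandwich_eq f c <-> sandwich_bs f %| c.
Proof.
rewrite /sandwich_bs; case: xgetP => // none.
suff [b hb] : exists b : {poly K}, (b = 0 \/ b \is monic) /\
    forall c, sandwich_eq f c <-> b %| c by case: (none b hb).
have eq0 : sandwich_eq f 0.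
  by exists [::] => n; rewrite big_nil horner0 scale0r.
have [|nz] := pselect (forall c, sandwich_eq f c -> c = 0).
  move=> z; exists 0; split; first by left.
  by move=> c; split=> [/z ->//|]; rewrite dvd0p => /eqP ->.
have ex : exists n, `[< exists c, [/\ sandwich_eq f c, c != 0 & size c = n] >].
  have [c /not_implyP[hc /eqP c0]] := (existsNP _).2 nz.
  by exists (size c); apply/asboolP; exists c.
case: (ex_minnP ex) => n /asboolP[b [hb b0 szb]] min.
have lb0 : lead_coef b != 0 by rewrite lead_coef_eq0.
exists ((lead_coef b)^-1 *: b); split.
  by right; rewrite monicE lead_coefZ mulVf.
move=> c; rewrite dvdpZl ?invr_eq0 //; split=> [hc|/dvdpP[q ->]]; last first.
  exact: sandwich_eqM.
have hr : sandwich_eq f (c %% b).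
  have -> : c %% b = (- (c %/ b)) * b + c.
    by rewrite {3}(divp_eq c b) mulNr addKr.
  by apply: sandwich_eqD => //; exact: sandwich_eqM.
apply: contraT => nd; have r0 : c %% b != 0 by [].
have := min (size (c %% b)); rewrite leqNgt -szb ltn_modp b0 => /(_ _)/negP h.
by exfalso; apply: h => //; apply/asboolP; exists (c %% b).
Qed.

End DiffOp.

Section Filtration.
Variables (K : fieldType) (A : algType K).

Definition linearly_simple (F : nat -> set A) : Prop :=
  exists C : nat, forall (t : nat) (r : A), F t r -> r != 0 ->
    kspan [set x | exists u v, [/\ F (C * t)%N u, F (C * t)%N v
                                 & x = u * r * v]] 1.

Variable M : lmodType A.

(* K acts on the A-module M through k |-> k%:A. *)
Definition ksubspace (U : set M) : Prop :=
  U 0 /\ forall (k : K) u v, U u -> U v -> U (k%:A *: u + v).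

Definition compatible_filtration (B : nat -> set A) (F : nat -> set M) : Prop :=
  [/\ forall i, ksubspace (F i),
      forall i, F i `<=` F i.+1,
      \bigcup_i F i = [set: M]
    & forall i j d m, B i d -> F j m -> F (i + j)%N (d *: m)].

Definition kfree (n : nat) (v : 'I_n -> M) : Prop :=
  forall c : 'I_n -> K, \sum_(i < n) (c i)%:A *: v i = 0 -> forall i, c i = 0.

Definition kdim (Re : realType) (U : set M) : \bar Re :=
  ereal_sup [set n%:R%:E | n in
    [set n | exists v : 'I_n -> M, (forall i, U (v i)) /\ kfree v]].

Definition Dim (Re : realType) (F : nat -> set M) : \bar Re :=
  ereal_inf [set t%:E | t in
    [set t : Re | 0 <= t /\
      (kdim Re (F n) * ((n%:R `^ t)^-1)%:E)%E @[n --> \oo] --> 0%E]].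

End Filtration.

Definition prime_ideal (R : comNzRingType) (P : {pred R}) : Prop :=
  idealr_closed P /\ prime_idealr_closed P.

Definition krull_dim (Re : realType) (R : comNzRingType) : \bar Re :=
  ereal_sup [set n%:R%:E | n in
    [set n : nat | exists P : nat -> {pred R},
       (forall i, (i <= n)%N -> prime_ideal (P i)) /\
       (forall i, (i < n)%N -> {subset P i <= P i.+1} /\
                               exists2 x, x \in P i.+1 & x \notin P i)]].

Section Segre.
Variables (K : fieldType) (a b : nat).

Definition xvar (i : 'I_a) : mpoly (a + b) K := mpolyX K (mnm1 (lshift b i)).
Definition yvar (j : 'I_b) : mpoly (a + b) K := mpolyX K (mnm1 (rshift a j)).

Definition segre_pred : {pred mpoly (a + b) K} :=
  adjoin [set p | exists i j, p = xvar i * yvar j].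

Record segre :=
  Segre { segre_val :> mpoly (a + b) K; _ : segre_val \in segre_pred }.

HB.instance Definition _ := [isSub for segre_val].
HB.instance Definition _ := [Choice of segre by <:].

Lemma segre_subalg_closed : GRing.subalg_closed segre_pred.
Proof.
split=> [|k p q /asboolP hp /asboolP hq|p q /asboolP hp /asboolP hq];
  apply/asboolP => T hT sT; have [T1 Tlin TM] := hT => //.
  by apply: Tlin; [exact: hp|exact: hq].
by apply: TM; [exact: hp|exact: hq].
Qed.

HB.instance Definition _ := GRing.isSubalgClosed.Build K (mpoly (a + b) K)
  segre_pred segre_subalg_closed.
HB.instance Definition _ := [SubChoice_isSubComNzRing of segre by <:].
HB.instance Definition _ := [SubZmodule_isSubLmodule of segre by <:].
HB.instance Definition _ := [SubNzRing_SubLmodule_isSubLalgebra of segre by <:].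
HB.instance Definition _ := [SubLalgebra_isSubAlgebra of segre by <:].

(* x_i y_j has degree 1 in R and degree 2 in the polynomial ring. *)
Definition segre_grading (d : nat) : set segre :=
  [set f | segre_val f \is ishomog1 d.*2 (@mdeg (a + b))].

End Segre.

(* Main.v *)
(* Write E for the Euler operator of R, d_i = d/dx_i, d'_j = d/dy_j. On R, seen
   as the span of the monomials of equal degree in x and y, the operators
   z_ij = x_i y_j, x_i d_k, y_j d'_k and d_i d'_j are differential operators, and
   the two Euler operators in x and in y coincide. From this coincidence one
   finds a universal sandwich map r |-> sum_k u_k r v_k, with u_k and v_k fixed
   in D_R, sending multiplication by g to multiplication by
   d_i d'_j (E + a - 1)(E + b - 1) g for every g in R. As this lowers degrees by
   one and is injective on non-constants, linearly many steps carry g to 1;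
   commutators with the z_ij first bring any operator to order 0. This is (1).

   For (2), n = a + b - 1 of the z_ij form a transcendence basis with commuting
   dual Euler operators T_l; the q^(2n) operators
   z^u prod_l T_l (T_l - 1) ... (T_l - g_l + 1), with u and g in [0, q)^n, lie in
   B^(Cq) and can be separated by sandwich maps of linear cost, whence
   q^(2n) <= (dim F^(Cq))^2. Comparing numbers of monomials, any n + 1 elements
   of R are algebraically dependent, so the Krull dimension is at most n.

   For (3), the same inequality for bimodules over C(s) shows that each nonzero
   quotient D(s) f^(s+j) D(s) / D(s) f^(s+j+1) D(s) contributes at least q^(2n)
   dimensions in degree Cq, while the elements u f^(s+j) v with u, v in B^(Cq)
   span a space of dimension O(q^(2n)), because
   u f^(s+j) v = f^(s-t) Q(s) with Q(s) of order and degree O(t). *)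
Require Import Defs.
From HB Require Import structures.
From mathcomp Require Import all_boot all_order all_algebra.
From mathcomp Require Import all_classical all_reals all_analysis.
From mathcomp Require Import complex.
From mathcomp Require Import zify ring.
From mathcomp Require mpoly.
Import -(notations) mpoly.
Set Implicit Arguments.
Unset Strict Implicit.
Unset Printing Implicit Defensive.
Import Order.TTheory GRing.Theory Num.Theory.
Local Open Scope classical_set_scope.
Local Open Scope ring_scope.

(** * Rank modulo a submodule *)

(** Zero columns pad the matrix to a square one; it is singular, and a singular matrix over a domain
    has a nonzero left null vector. *)
Lemma left_kernel (A : idomainType) (I J : finType) (m : I -> J -> A) :
  (#|J| < #|I|)%N ->
  exists2 c : I -> A, exists i, c i != 0 & forall j, \sum_i c i * m i j = 0.
Proof.
move=> ltJI.
pose M : 'M[A]_#|I| := \matrix_(p, q)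
  if insub (val q) is Some q' then m (enum_val p) (@enum_val J predT q') else 0.
have : \det M == 0.
  rewrite -det_tr; apply/det0P; exists (delta_mx 0 (Ordinal ltJI)).
    by apply/eqP => /matrixP/(_ 0 (Ordinal ltJI))/eqP; rewrite !mxE !eqxx oner_eq0.
  rewrite -rowE; apply/rowP => j; rewrite !mxE insubF //= ltnn //.
case/det0P => v v0 vM.
exists (fun i => v 0 (enum_rank i)).
  have [p vp] : exists p, v 0 p != 0.
    apply/existsP; apply: contraNT v0 => /existsPn v0.
    by apply/eqP/rowP => j; rewrite mxE; apply/eqP/negPn/v0.
  by exists (enum_val p); rewrite enum_valK.
move=> j; have lt := leq_trans (ltn_ord (enum_rank j)) (ltnW ltJI).
have /matrixP/(_ 0 (Ordinal lt)) := vM; rewrite !mxE => {2}<-.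
rewrite (reindex (@enum_val I predT)); last first.
  by exists enum_rank => ? _; rewrite ?enum_valK ?enum_rankK.
apply: eq_bigr => p _; rewrite !mxE enum_valK insubT ?ltn_ord //= => h.
by rewrite (_ : Sub _ _ = enum_rank j) ?enum_rankK //; apply: val_inj.
Qed.

Section FreeModulo.
Variables (A : idomainType) (M : lmodType A).
Implicit Types (N G : set M).

(** A submodule with torsion-free quotient: ranks modulo [N] can then be counted over [A] without
    passing to the fraction field. *)
Definition saturated N := [/\ N 0, forall a u v, N u -> N v -> N (a *: u + v)
  & forall a u, a != 0 -> N (a *: u) -> N u].

Definition free_mod N (I : finType) (v : I -> M) :=
  forall c : I -> A, N (\sum_i c i *: v i) -> forall i, c i = 0.

Lemma saturated_sum N (I : Type) (r : seq I) (P : pred I) (a : I -> A) (v : I -> M) :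
  saturated N -> (forall i, P i -> N (v i)) -> N (\sum_(i <- r | P i) a i *: v i).
Proof.
move=> [N0 ND _] Nv; elim: r => [|i r IH]; first by rewrite big_nil.
by rewrite big_cons; case: ifP => // Pi; apply: ND => //; exact: Nv.
Qed.

(** A maximal free family does it: adjoining [u] creates a relation, in which the coefficient [a] of
    [u] cannot vanish. *)
Lemma free_mod_spanning N G q : saturated N ->
  (forall v : 'I_q -> M, (forall i, G (v i)) -> ~ free_mod N v) ->
  exists (d : nat) (v : 'I_d -> M), [/\ (d < q)%N, forall i, G (v i)
    & forall u, G u -> exists a (c : 'I_d -> A),
        a != 0 /\ N (a *: u - \sum_i c i *: v i)].
Proof.
move=> satN; have [N0 ND Nsat] := satN.
elim: q => [|q IH] nofree.
  by exfalso; apply: (nofree (fun _ => 0)) => [[]|c _ []].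
have [[v [Gv fv]]|nov] :=
    pselect (exists v : 'I_q -> M, (forall i, G (v i)) /\ free_mod N v); last first.
  have [|d [v [dq Gv span]]] := IH.
    by move=> v Gv fv; apply: nov; exists v.
  by exists d, v; split=> //; apply: ltnW.
exists q, v; split=> // u Gu.
pose w i := if unlift ord0 i is Some j then v j else u.
have /nofree/existsNP[c /not_implyP[Nc /existsNP[i ci]]] : forall i, G (w i).
  by move=> i; rewrite /w; case: unliftP.
move: Nc; rewrite big_ord_recl /w unlift_none.
under eq_bigr do rewrite liftK.
move=> Nc.
exists (c ord0), (fun j => - c (lift ord0 j)); split; last first.
  by under eq_bigr do rewrite scaleNr; rewrite sumrN opprK.
apply/eqP => c0; rewrite c0 scale0r add0r in Nc.
apply: ci; case: (unliftP ord0 i) => [j|] -> //.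
exact: (fv (fun j => c (lift ord0 j))).
Qed.

(* If [G] and [G'] had rank less than [q] modulo [N], the maps [T p] would be
   described modulo [N] by fewer than [#|I|] coefficients. *)
Lemma free_mod_exists N G G' (I : finType) (T : I -> M -> M) q :
    saturated N -> (forall p, linear (T p)) -> (forall p u, N u -> N (T p u)) ->
    (forall u, G u -> G' u) -> (forall p u, G u -> G' (T p u)) ->
    (forall c : I -> A, (exists p, c p != 0) ->
       exists2 u, G u & ~ N (\sum_p c p *: T p u)) ->
    (q * q <= #|I|)%N ->
  exists v : 'I_q -> M, (forall i, G' (v i)) /\ free_mod N v.
Proof.
move=> satN linT NT GG' GT nz leqI; have [N0 ND Nsat] := satN.
pose TL p : {linear M -> M} := HB.pack (T p) (GRing.isLinear.Build _ _ _ _ (T p) (linT p)).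
have TZ p k x : T p (k *: x) = k *: T p x := linearZ_LR (TL p) k x.
apply: contrapT => /forallNP nofree.
have nofree' (v : 'I_q -> M) : (forall i, G' (v i)) -> ~ free_mod N v.
  by move=> Gv fv; apply: (nofree v); split.
have [d' [g' [d'q Gg' span']]] := free_mod_spanning satN nofree'.
have [|d [g [dq Gg span]]] := free_mod_spanning (G := G) (q := q) satN.
  by move=> v Gv; apply: nofree' => i; apply: GG'.
have /choice[am amP] (x : I * 'I_d) : exists am : A * ('I_d' -> A),
    am.1 != 0 /\ N (am.1 *: T x.1 (g x.2) - \sum_k am.2 k *: g' k).
  by have [a [c ac]] := span' _ (GT x.1 _ (Gg x.2)); exists (a, c).
(* [al p] is a common denominator of the images [T p (g i)], and [mm p (i, k)] is the coefficient of
   [g' k] in [al p *: T p (g i)] modulo [N]. *)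
pose al p := \prod_i (am (p, i)).1.
have al0 p : al p != 0 by apply/prodf_neq0 => i _; case: (amP (p, i)).
pose mm p (y : 'I_d * 'I_d') :=
  (\prod_(i | i != y.1) (am (p, i)).1) * (am (p, y.1)).2 y.2.
(* There are fewer than [q * q] pairs [(i, k)], so a nonzero [c] cancels all these coefficients. The
   resulting combination of the [T p] sends each [g i] into [N], hence also each [u] in [G], as some
   nonzero multiple of [u] is a combination of the [g i] modulo [N]. *)
have [|c [p0 cp0] cm] := @left_kernel _ I ('I_d * 'I_d')%type mm.
  rewrite card_prod !card_ord; apply: leq_trans leqI.
  by apply: leq_ltn_trans (_ : d * q < _)%N; nia.
have Tg i : N (\sum_p (c p * al p) *: T p (g i)).
  have E : \sum_p (c p * al p) *: T p (g i) =
     \sum_p (c p * \prod_(k | k != i) (am (p, k)).1) *: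
        ((am (p, i)).1 *: T p (g i) - \sum_k (am (p, i)).2 k *: g' k).
    under [RHS]eq_bigr => p _.
      rewrite scalerBr scalerA (_ : _ * _ * _ = c p * al p); last first.
        by rewrite -mulrA /al [in RHS](bigD1 i) //= [X in _ * X]mulrC.
      rewrite scaler_sumr; over.
    rewrite big_split /= sumrN exchange_big /= [X in _ - X]big1 ?subr0 //.
    move=> k _; under eq_bigr do rewrite scalerA -mulrA.
    by rewrite -scaler_suml (cm (i, k)) scale0r.
  rewrite E; apply: saturated_sum => // p _; exact: (amP (p, i)).2.
have [|u Gu] := nz (fun p => c p * al p); first by exists p0; rewrite mulf_neq0.
apply; have [a [e [a0 Ne]]] := span u Gu.
apply: (Nsat a) => //.
have -> : a *: (\sum_p (c p * al p) *: T p u) =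
  \sum_p (c p * al p) *: T p (a *: u - \sum_i e i *: g i) +
  \sum_i e i *: (\sum_p (c p * al p) *: T p (g i)).
  under [X in _ + X]eq_bigr do rewrite scaler_sumr.
  rewrite [X in _ + X]exchange_big /= -big_split scaler_sumr.
  apply: eq_bigr => p _ /=; rewrite -[T p]/(TL p : M -> M) linearB linear_sum /= TZ.
  rewrite scalerBr scalerA -[_ * a]mulrC -scalerA -[LHS](subrK (\sum_i e i *: ((c p * al p) *: T
    p (g i)))).
  congr (_ - _ + _); [by rewrite !scalerA mulrA|rewrite scaler_sumr]; apply: eq_bigr => i _.
  by rewrite TZ !scalerA [e i * _]mulrC.
rewrite -[X in X + _]scale1r; apply: ND; last exact: saturated_sum.
by apply: saturated_sum => // p _; apply: NT.
Qed.

End FreeModulo.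

(** * Monomials of the Segre ring *)

Section SegreMonomials.
Variables (K : fieldType) (a b : nat).
Local Notation S := (mpoly (a + b) K).
Local Notation R := (segre K a b).
Local Notation mon := (mpolyX K).
Implicit Types (m : multinom (a + b)) (p q : S) (f g : R).

Definition xdeg m : nat := \sum_(i < a) m (lshift b i).
Definition ydeg m : nat := \sum_(j < b) m (rshift a j).
(** These monomials form a basis of the Segre ring; see [segre_predP]. *)
Definition balanced m : bool := xdeg m == ydeg m.

Lemma mdeg_xydeg m : mdeg m = (xdeg m + ydeg m)%N.
Proof. by rewrite mdegE big_split_ord. Qed.

Lemma xdegD m1 m2 : xdeg (mnm_add m1 m2) = (xdeg m1 + xdeg m2)%N.
Proof. by rewrite -big_split; apply: eq_bigr => i _; rewrite mnmDE. Qed.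

Lemma ydegD m1 m2 : ydeg (mnm_add m1 m2) = (ydeg m1 + ydeg m2)%N.
Proof. by rewrite -big_split; apply: eq_bigr => i _; rewrite mnmDE. Qed.

Lemma xdeg0 : xdeg mnm0 = 0%N.
Proof. by rewrite /xdeg big1 // => i _; rewrite mnm0E. Qed.

Lemma ydeg0 : ydeg mnm0 = 0%N.
Proof. by rewrite /ydeg big1 // => i _; rewrite mnm0E. Qed.

Lemma xdeg1x i : xdeg (mnm1 (lshift b i)) = 1%N.
Proof.
rewrite /xdeg (bigD1 i) //= mnm1E eqxx big1 ?addn0 // => k ki.
by rewrite mnm1E (inj_eq (@lshift_inj _ _)) eq_sym (negPf ki).
Qed.

Lemma xdeg1y j : xdeg (mnm1 (rshift a j)) = 0%N.
Proof. by rewrite /xdeg big1 // => k _; rewrite mnm1E eq_rlshift. Qed.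

Lemma ydeg1x i : ydeg (mnm1 (lshift b i)) = 0%N.
Proof. by rewrite /ydeg big1 // => k _; rewrite mnm1E eq_lrshift. Qed.

Lemma ydeg1y j : ydeg (mnm1 (rshift a j)) = 1%N.
Proof.
rewrite /ydeg (bigD1 j) //= mnm1E eqxx big1 ?addn0 // => k kj.
by rewrite mnm1E (inj_eq (@rshift_inj _ _)) eq_sym (negPf kj).
Qed.

Definition xydegE := (xdegD, ydegD, xdeg0, ydeg0, xdeg1x, xdeg1y, ydeg1x, ydeg1y).

Lemma balancedD m1 m2 : balanced m1 -> balanced m2 -> balanced (mnm_add m1 m2).
Proof. by rewrite /balanced !xydegE => /eqP -> /eqP ->. Qed.

Lemma balanced0 : balanced mnm0.
Proof. by rewrite /balanced !xydegE. Qed.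

Lemma xdeg_eq0 m i : xdeg m = 0%N -> m (lshift b i) = 0%N.
Proof. by move=> /eqP; rewrite sum_nat_eq0 => /forallP/(_ i)/eqP. Qed.

Lemma ydeg_eq0 m j : ydeg m = 0%N -> m (rshift a j) = 0%N.
Proof. by move=> /eqP; rewrite sum_nat_eq0 => /forallP/(_ j)/eqP. Qed.

Lemma balanced_eq0 m : balanced m -> xdeg m = 0%N -> m = mnm0.
Proof.
move=> /eqP e x0; apply/mnmP => k; rewrite mnm0E -(splitK k).
by case: (fintype.split k) => i /=; [exact: xdeg_eq0|apply: ydeg_eq0; rewrite -e].
Qed.

Lemma xdeg_gt0 m : (0 < xdeg m)%N -> exists i, (0 < m (lshift b i))%N.
Proof.
move=> h; apply/existsP; apply: contraTT h => /existsPn h.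
rewrite -leqNgt leqn0 sum_nat_eq0; apply/forallP => i; apply/implyP => _.
by rewrite -leqn0 leqNgt h.
Qed.

Lemma ydeg_gt0 m : (0 < ydeg m)%N -> exists j, (0 < m (rshift a j))%N.
Proof.
move=> h; apply/existsP; apply: contraTT h => /existsPn h.
rewrite -leqNgt leqn0 sum_nat_eq0; apply/forallP => i; apply/implyP => _.
by rewrite -leqn0 leqNgt h.
Qed.

Definition mnmz (i : 'I_a) (j : 'I_b) := mnm_add (mnm1 (lshift b i)) (mnm1 (rshift a j)).

Lemma balancedz i j : balanced (mnmz i j).
Proof. by rewrite /balanced !xydegE. Qed.

(** Some $x_i$ and some $y_j$ divide a nonconstant balanced monomial; this drives the inductions on
    [xdeg]. *)
Lemma balanced_split m : balanced m -> (0 < xdeg m)%N ->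
  exists i j m', [/\ balanced m', m = mnm_add (mnmz i j) m' & xdeg m = (xdeg m').+1].
Proof.
move=> bm x0; have y0 : (0 < ydeg m)%N by rewrite -(eqP bm).
have [i mi] := xdeg_gt0 x0; have [j mj] := ydeg_gt0 y0.
have e : m = mnm_add (mnmz i j) (mnm_sub m (mnmz i j)).
  rewrite addmC submK //; apply/mnm_lepP => k; rewrite mnmDE !mnm1E.
  case: eqP => [<-|_]; first by rewrite eq_rlshift.
  by case: eqP => [<-|_].
exists i, j, (mnm_sub m (mnmz i j)); split=> //.
  by move: bm; rewrite /balanced {1 2}e !xydegE.
by rewrite {1}e !xydegE.
Qed.

Lemma mcoeff_suppP p m : reflect (mcoeff m p != 0) (m \in msupp p).
Proof. by rewrite mcoeff_msupp; exact: idP. Qed.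

Lemma mcoeffX_neq0 m1 m : mcoeff m (mon m1) != 0 -> m = m1.
Proof. by rewrite mcoeffX; case: (eqVneq m1 m) => // _; rewrite eqxx. Qed.

Lemma mon_segre m : balanced m -> mon m \in @segre_pred K a b.
Proof.
have [n] := ubnP (xdeg m); elim: n m => // n IH m le bm.
have [x0|] := posnP (xdeg m).
  by rewrite (balanced_eq0 bm x0) mpolyX0 rpred1.
move=> /(balanced_split bm)[i [j [m' [bm' mE e]]]]; rewrite mE.
rewrite mpolyXD rpredM //; last by apply: IH => //; move: le; rewrite e.
apply/asboolP => T _; apply; exists i, j; by rewrite /xvar /yvar -mpolyXD.
Qed.

(** The polynomials supported on balanced monomials form a subalgebra containing the generators;
    conversely, a balanced monomial is a product of generators. *)
Lemma segre_predP p : reflect (forall m, mcoeff m p != 0 -> balanced m)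
  (p \in @segre_pred K a b).
Proof.
apply: (iffP idP) => [/asboolP h m|h]; last first.
  rewrite [p]mpolyE big_seq rpred_sum // => m mp; rewrite rpredZ // mon_segre //.
  exact/h/mcoeff_suppP.
have [T TE] : exists T : {pred S}, forall p, p \in T <-> (forall m, mcoeff m p != 0 -> balanced
  m).
  exists (fun p => `[< forall m, mcoeff m p != 0 -> balanced m >]) => p'.
  by split=> [/asboolP|?]; last exact/asboolP.
apply: (TE p).1; apply: h => [|y [i [j ->]]]; last first.
  by apply/TE => m'; rewrite /xvar /yvar -mpolyXD => /mcoeffX_neq0 ->; exact: balancedz.
split=> [|k u v|u v].
- by apply/TE => m'; rewrite -mpolyX0 => /mcoeffX_neq0 ->; exact: balanced0.
- move=> /TE hu /TE hv; apply/TE => m'; rewrite mcoeffD mcoeffZ => nz.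
  have [u0|] := eqVneq (mcoeff m' u) 0; last exact: hu.
  by apply: hv; move: nz; rewrite u0 mulr0 add0r.
- move=> /TE hu /TE hv; apply/TE => m' /mcoeff_suppP/msuppM_le/allpairsP.
  case=> -[m1 m2] /= [/mcoeff_suppP/hu b1 /mcoeff_suppP/hv b2 ->]; exact: balancedD.
Qed.

Lemma segre_valM f g : segre_val (f * g) = segre_val f * segre_val g.
Proof. exact: (rmorphM (val : R -> S)). Qed.

Lemma segre_val1 : segre_val (1 : R) = 1.
Proof. exact: (rmorph1 (val : R -> S)). Qed.

Lemma segre_valZ c f : segre_val (c *: f) = c *: segre_val f.
Proof. by []. Qed.

Lemma segre_valD f g : segre_val (f + g) = segre_val f + segre_val g.
Proof. exact: (rmorphD (val : R -> S)). Qed.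

Lemma segre_valB f g : segre_val (f - g) = segre_val f - segre_val g.
Proof. exact: (rmorphB (val : R -> S)). Qed.

Lemma segre_val0 : segre_val (0 : R) = 0.
Proof. exact: (rmorph0 (val : R -> S)). Qed.

Lemma segre_val_sum I (r : seq I) (P : pred I) (F : I -> R) :
  segre_val (\sum_(i <- r | P i) F i) = \sum_(i <- r | P i) segre_val (F i).
Proof. exact: (raddf_sum (val : R -> S)). Qed.

Lemma segre_balanced f m : mcoeff m (segre_val f) != 0 -> balanced m.
Proof. by move: m; apply/segre_predP; exact: valP f. Qed.

(* [smon m] is [0] when [m] is not balanced. *)
Definition smon m : R := insubd (0 : R) (mon m).

Lemma val_smon m : balanced m -> segre_val (smon m) = mon m.
Proof. by move=> bm; rewrite -[segre_val _]/(val _) val_insubd mon_segre. Qed.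

Lemma smonD m1 m2 : balanced m1 -> balanced m2 ->
  smon (mnm_add m1 m2) = smon m1 * smon m2.
Proof.
move=> b1 b2; apply: val_inj; rewrite [RHS]segre_valM [LHS]val_smon ?balancedD // !val_smon //.
exact: mpolyXD.
Qed.

Lemma smon0 : smon mnm0 = 1.
Proof. by apply: val_inj; rewrite [RHS]segre_val1 [LHS]val_smon ?balanced0 // mpolyX0. Qed.

Lemma segreE f : f = \sum_(m <- msupp (segre_val f)) mcoeff m (segre_val f) *: smon m.
Proof.
apply: val_inj; rewrite [LHS]mpolyE [RHS]segre_val_sum big_seq [RHS]big_seq.
apply: eq_bigr => m /mcoeff_suppP/segre_balanced bm.
by rewrite segre_valZ val_smon.
Qed.

Definition sgen i j : R := smon (mnmz i j).

Lemma smon_ind (P : R -> Prop) :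
  P 1 -> (forall i j f, P f -> P (sgen i j * f)) ->
  forall m, balanced m -> P (smon m).
Proof.
move=> P1 PM m; have [n] := ubnP (xdeg m); elim: n m => // n IH m le bm.
have [x0|] := posnP (xdeg m); first by rewrite (balanced_eq0 bm x0) smon0.
move=> /(balanced_split bm)[i [j [m' [bm' mE e]]]]; rewrite mE.
rewrite smonD ?balancedz //; by apply/PM/IH => //; move: le; rewrite e.
Qed.

(** On balanced monomials [xdeg] is the degree in the Segre grading, half the degree as a
    polynomial. *)
Definition deg_le d f := forall m, mcoeff m (segre_val f) != 0 -> (xdeg m <= d)%N.

Lemma deg_le0 d : deg_le d 0.
Proof. by move=> m; rewrite segre_val0 mcoeff0 eqxx. Qed.

Lemma deg_leD d c f g : deg_le d f -> deg_le d g -> deg_le d (c *: f + g).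
Proof.
move=> hf hg m; rewrite /= mcoeffD mcoeffZ => nz.
have [f0|] := eqVneq (mcoeff m (segre_val f)) 0; last exact: hf.
by apply: hg; move: nz; rewrite f0 mulr0 add0r.
Qed.

Lemma deg_leW d e f : (d <= e)%N -> deg_le d f -> deg_le e f.
Proof. by move=> de hf m /hf /leq_trans; apply. Qed.

Lemma deg_leM d e f g : deg_le d f -> deg_le e g -> deg_le (d + e) (f * g).
Proof.
move=> hf hg m; rewrite segre_valM => /mcoeff_suppP/msuppM_le/allpairsP.
case=> -[m1 m2] /= [/mcoeff_suppP/hf b1 /mcoeff_suppP/hg b2 ->].
by rewrite xdegD leq_add.
Qed.

Lemma deg_leX d f k : deg_le d f -> deg_le (k * d) (f ^+ k).
Proof.
move=> df; elim: k => [|k IH]; last by rewrite exprS mulSn; exact: deg_leM.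
move=> m; rewrite expr0 segre_val1 mcoeff1; case: (eqVneq m mnm0) => [->|].
  by rewrite xdeg0.
by rewrite eqxx.
Qed.

Lemma deg_le_smon m d : (xdeg m <= d)%N -> deg_le d (smon m).
Proof.
move=> md m'; have [bm|nb] := boolP (balanced m).
  by rewrite val_smon // => /mcoeffX_neq0 ->.
rewrite -[segre_val _]/(val (insubd (0 : R) _)) val_insubd; case: ifP => [|_].
  move=> /segre_predP/(_ m); rewrite mcoeffX eqxx oner_eq0 => /(_ isT).
  by rewrite (negPf nb).
by rewrite mcoeff0 eqxx.
Qed.

Lemma deg_le_gen i j : deg_le 1 (sgen i j).
Proof. by apply: deg_le_smon; rewrite !xydegE. Qed.

Lemma deg_le_exists f : exists d, deg_le d f.
Proof.
exists (\max_(m <- msupp (segre_val f)) xdeg m)%N => m /mcoeff_suppP mf.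
by rewrite (big_rem m mf) leq_maxl.
Qed.

Lemma deg_le_const f : deg_le 0 f -> f = (mcoeff mnm0 (segre_val f))%:A.
Proof.
move=> h; apply: val_inj; apply/mpolyP => m;
  rewrite [val (_%:A)]segre_valZ segre_val1 mcoeffZ mcoeff1.
have [->|m0] := eqVneq m mnm0; rewrite ?mulr1 // mulr0.
apply/eqP; apply: contraNT m0 => nz.
apply/eqP/balanced_eq0; first exact: segre_balanced nz.
by apply/eqP; rewrite -leqn0; exact: h.
Qed.

Lemma segre_gradingP d f : segre_grading d f <->
  forall m, mcoeff m (segre_val f) != 0 -> xdeg m = d.
Proof.
rewrite /segre_grading /=; split=> [/dhomogP h m nz|h].
  have := h m; move/(_ (introT (mcoeff_suppP _ _) nz)).
  rewrite -[X in X = _]/(mdeg m) mdeg_xydeg -(eqP (segre_balanced nz)) addnn.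
  exact: double_inj.
apply/dhomogP => m /mcoeff_suppP nz.
by rewrite -[LHS]/(mdeg m) mdeg_xydeg -(eqP (segre_balanced nz)) addnn h.
Qed.

Lemma grading_smon m : balanced m -> segre_grading (xdeg m) (smon m).
Proof.
move=> bm; by apply/segre_gradingP => m'; rewrite val_smon // => /mcoeffX_neq0 ->.
Qed.

End SegreMonomials.
Arguments smon K {a b} m.
Arguments sgen K {a b} i j.

(** * Orders, degrees and the Bernstein filtration *)

Section Span.
Variables (K : fieldType) (V : lmodType K).
Implicit Types (X : set V).

Lemma kspan_sub X v : X v -> kspan X v.
Proof.
move=> Xv; exists 1%N, (fun _ => 1), (fun _ => v); split=> //.
by rewrite big_ord_recl big_ord0 scale1r addr0.
Qed.

Lemma kspan_comb X (c : K) u v : kspan X u -> kspan X v -> kspan X (c *: u + v).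
Proof.
move=> [n [d [u' [Xu ->]]]] [n' [d' [v' [Xv ->]]]]; exists (n + n')%N.
exists (fun i => match fintype.split i with inl j => c * d j | inr j => d' j end).
exists (fun i => match fintype.split i with inl j => u' j | inr j => v' j end).
split; first by move=> i; case: fintype.split.
rewrite big_split_ord scaler_sumr; congr (_ + _); apply: eq_bigr => i _.
  by rewrite (unsplitK (inl i)) scalerA.
by rewrite (unsplitK (inr i)).
Qed.

Lemma kspan0 X : kspan X 0.
Proof. by exists 0%N, (fun _ => 0), (fun _ => 0); split=> [[]|]; rewrite ?big_ord0. Qed.

Lemma kspan_min X (Y : set V) : (forall v, X v -> Y v) -> Y 0 ->
  (forall (c : K) u v, Y u -> Y v -> Y (c *: u + v)) -> forall v, kspan X v -> Y v.
Proof.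
move=> XY Y0 YD v [n [c [u [Xu ->]]]].
by elim/big_rec: _ => // i x _; apply: YD; apply: XY.
Qed.

Lemma kspan_sum X I (r : seq I) (P : pred I) (F : I -> V) :
  (forall i, P i -> kspan X (F i)) -> kspan X (\sum_(i <- r | P i) F i).
Proof.
move=> XF; elim/big_rec: _ => [|i x Pi Xx]; first exact: kspan0.
by rewrite -[F i]scale1r; apply: kspan_comb => //; exact: XF.
Qed.

End Span.

(** * Differential operators as linear maps *)

Section DiffopBasics.
Variables (K : fieldType) (R : comAlgType K).
Local Notation D := (diffop R).
Implicit Types (d e : D) (r f g : R).

HB.instance Definition _ d :=
  GRing.isLinear.Build K R R _ (diffop_fun d) (@diffop_linear K R d).

Lemma diffopM d e f : (d * e) f = d (e f). Proof. by []. Qed.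
Lemma diffopD d e f : (d + e) f = d f + e f. Proof. by []. Qed.
Lemma diffopB d e f : (d - e) f = d f - e f. Proof. by []. Qed.
Lemma diffop0 f : (0 : D) f = 0. Proof. by []. Qed.
Lemma diffop1 f : (1 : D) f = f. Proof. exact: mul1r. Qed.
Lemma diffopZ (c : K) d f : (c *: d) f = c *: d f. Proof. by []. Qed.
Lemma diffop_fD d f g : d (f + g) = d f + d g. Proof. exact: linearD. Qed.
Lemma diffop_fZ (c : K) d f : d (c *: f) = c *: d f.
Proof. exact: (linearZ_LR (diffop_fun d)). Qed.
Lemma mulopE r f : mulop r f = r * f. Proof. by []. Qed.

Lemma diffop_sum I (r : seq I) (P : pred I) (F : I -> D) f :
  (\sum_(i <- r | P i) F i) f = \sum_(i <- r | P i) F i f.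
Proof. by elim/big_rec2: _ => // i x y _ <-. Qed.

Lemma mulop_comb (c : K) r f : mulop (c *: r + f) = c *: mulop r + mulop f.
Proof. by apply: diffop_eq => g; rewrite diffopD diffopZ !mulopE mulrDl scalerAl. Qed.

Lemma mulop_is_linear : linear (@mulop K R).
Proof. exact: mulop_comb. Qed.

Lemma mulop_is_monoid_morphism : monoid_morphism (@mulop K R).
Proof. by split=> [|r s]; apply: diffop_eq => // g; rewrite diffopM !mulopE mulrA. Qed.

HB.instance Definition _ := GRing.isLinear.Build K R D _ (@mulop K R) mulop_is_linear.
HB.instance Definition _ :=
  GRing.isMonoidMorphism.Build R D (@mulop K R) mulop_is_monoid_morphism.

Lemma mulopC r s : mulop r * mulop s = mulop s * mulop r.
Proof. by rewrite -!rmorphM mulrC. Qed.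

Lemma diff_le_ord d : diff_le (diffop_ord d) d.
Proof. by rewrite /diffop_ord; case: ex_minnP => n /asboolP. Qed.

Lemma ord_le d n : diff_le n d -> (diffop_ord d <= n)%N.
Proof. by move=> h; rewrite /diffop_ord; case: ex_minnP => m _; apply; apply/asboolP. Qed.

Lemma diff_le_bracket n d r : diff_le n.+1 d -> diff_le n (d * mulop r - mulop r * d).
Proof. by move=> [_ /(_ r)]. Qed.

Lemma diff_leP0 d : diff_le 0 d -> d = mulop (d 1).
Proof. by move=> [r dr]; apply: diffop_eq => f; rewrite mulopE dr mulr1. Qed.

Lemma diff_leM m n d e : diff_le m d -> diff_le n e -> diff_le (m + n) (d * e).
Proof. exact: diff_le_comp. Qed.

End DiffopBasics.

(** * Homogeneous and bounded operators on the Segre ring *)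

Section Filtered.
Variables (K : fieldType) (a b : nat).
Local Notation R := (segre K a b).
Local Notation D := (diffop R).
Local Notation gr := (@segre_grading K a b).
Implicit Types (d : D) (w : int) (f g : R) (m : multinom (a + b)).

Lemma mcoeff_diffop d f m' : mcoeff m' (segre_val (d f)) != 0 ->
  exists m, [/\ balanced m, mcoeff m (segre_val f) != 0
    & mcoeff m' (segre_val (d (smon K m))) != 0].
Proof.
rewrite {1}[f]segreE linear_sum segre_val_sum raddf_sum /= => nz.
apply: contrapT => /forallNP h; move: nz; rewrite big_seq big1 ?eqxx // => m.
move=> /mcoeff_suppP mf; have bm := segre_balanced mf.
rewrite linearZ segre_valZ mcoeffZ; apply/eqP; rewrite mulf_eq0 (negPf mf) /=.
by apply/negPn/negP => nz; apply: (h m); split.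
Qed.

Lemma diffop_ext d (e : D) : (forall m, balanced m -> d (smon K m) = e (smon K m)) -> d = e.
Proof.
move=> h; apply: diffop_eq => f; rewrite [f]segreE !linear_sum big_seq [RHS]big_seq.
by apply: eq_bigr => m /mcoeff_suppP/segre_balanced/h hm; rewrite !linearZ /= hm.
Qed.

(** Degrees are compared in [int], so that one equation also covers negative target degrees, where
    it forces the image to vanish. *)
Lemma homog_opP d (k : int) : homog_op gr d k <->
  (forall m, balanced m -> forall m', mcoeff m' (segre_val (d (smon K m))) != 0 ->
     (xdeg m')%:Z = (xdeg m)%:Z + k).
Proof.
split=> [h m bm m'|h j f /segre_gradingP fj].
  move: (h _ _ (grading_smon K bm)); case: (_ + k) => [l /segre_gradingP hl /hl -> //|l ->].
  by rewrite segre_val0 mcoeff0 eqxx.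
have {}h m' : mcoeff m' (segre_val (d f)) != 0 -> (xdeg m')%:Z = j%:Z + k.
  by move=> /mcoeff_diffop[m [bm /fj <- /h->]].
case e: (j%:Z + k) => [l|l].
  by apply/segre_gradingP => m' /h; rewrite e => -[].
apply: val_inj; rewrite [val 0]segre_val0; apply/mpolyP => m'; rewrite mcoeff0.
by apply/eqP; apply: contraT => /h; rewrite e.
Qed.

(** Commuting with the algebra generators amounts to being $R$-linear. *)
Lemma commute_gens d :
  (forall i j, d * mulop (sgen K i j) = mulop (sgen K i j) * d) -> d = mulop (d 1).
Proof.
move=> h; apply: diffop_ext => m bm; rewrite mulopE mulrC.
elim/smon_ind: bm => [|i j f IH]; first by rewrite mul1r.
by rewrite -[X in d X]/(mulop _ f) -diffopM h diffopM IH mulopE mulrA.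
Qed.

Lemma commute_gens_dec d : d = mulop (d 1) \/
  exists i j, d * mulop (sgen K i j) - mulop (sgen K i j) * d != 0.
Proof.
have [h|/existsNP[i /existsNP[j /eqP h]]] :=
  pselect (forall i j, d * mulop (sgen K i j) = mulop (sgen K i j) * d).
  by left; exact: commute_gens.
by right; exists i, j; rewrite subr_eq0.
Qed.

(** Brackets with the generators lower the order by one and vanish on monomials of degree one less.
    By induction they are zero, so [d] is multiplication by [d 1], which is zero. *)
Lemma diff_le_eq0 n d : diff_le n d ->
  (forall m, balanced m -> (xdeg m <= n)%N -> d (smon K m) = 0) -> d = 0.
Proof.
elim: n d => [|n IH] d hd h.
  by rewrite (diff_leP0 hd) -smon0 h ?balanced0 ?xdeg0 // raddf0.
have [->|[i [j]]] := commute_gens_dec d.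
  by rewrite -smon0 h ?balanced0 ?xdeg0 // raddf0.
move=> /eqP[]; apply: IH; first exact: diff_le_bracket.
move=> m bm mn; rewrite diffopB !diffopM !mulopE -smonD ?balancedz //.
rewrite !h ?mulr0 ?subrr //; first exact: leqW.
  by rewrite balancedD ?balancedz.
by rewrite xdegD !xydegE.
Qed.

Lemma homog_bracket d k i j : homog_op gr d k ->
  homog_op gr (d * mulop (sgen K i j) - mulop (sgen K i j) * d) (k + 1).
Proof.
move=> /homog_opP h; apply/homog_opP => m bm m'.
rewrite diffopB !diffopM !mulopE -smonD ?balancedz // segre_valB mcoeffB => nz.
have [|] := boolP (mcoeff m' (segre_val (d (smon K (mnm_add (mnmz i j) m)))) != 0).
  move=> /h ->; last by rewrite balancedD ?balancedz.
  by rewrite xdegD !xydegE; lia.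
rewrite negbK => /eqP z; move: nz; rewrite z sub0r oppr_eq0 segre_valM.
move=> /mcoeff_suppP/msuppM_le/allpairsP[[m1 m2] /= []].
rewrite val_smon ?balancedz // => /mcoeff_suppP/mcoeffX_neq0 m1E /mcoeff_suppP/(h _ bm) m2E ->.
by rewrite m1E xdegD PoszD m2E !xydegE; lia.
Qed.

(** A bracket with a generator raises the degree by one and lowers the order by one; a nonzero
    multiplication operator has nonnegative degree. *)
Lemma homog_deg_ge n d k : homog_op gr d k -> diff_le n d -> d != 0 -> - n%:Z <= k.
Proof.
elim: n d k => [|n IH] d k hd nd d0.
  rewrite oppr0; case: k hd => // l /(_ 0%N 1).
  rewrite -smon0 -(xdeg0 a b) => /(_ (grading_smon K (balanced0 a b))).
  rewrite xdeg0 add0r smon0 => /= d10.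
  by move: d0; rewrite (diff_leP0 nd) d10 raddf0 eqxx.
have [dE|[i [j nz]]] := commute_gens_dec d.
  have : - 0%:Z <= k; last by lia.
  case: k hd => // l /(_ 0%N 1).
  rewrite -smon0 -(xdeg0 a b) => /(_ (grading_smon K (balanced0 a b))).
  rewrite xdeg0 add0r smon0 => /= d10.
  by move: d0; rewrite dE d10 raddf0 eqxx.
by have := IH _ _ (homog_bracket i j hd) (diff_le_bracket _ nd) nz; lia.
Qed.

Definition bounded_op n e d :=
  diff_le n d /\ forall m, balanced m -> deg_le (xdeg m + e) (d (smon K m)).

Lemma bounded_op_deg n e d j f : bounded_op n e d -> deg_le j f -> deg_le (j + e) (d f).
Proof.
move=> [_ h] fj m' /mcoeff_diffop[m [bm /fj mj /(h m bm)]] /leq_trans; apply.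
by rewrite leq_add2r.
Qed.

Lemma bounded_op_comb n e (c : K) d d' :
  bounded_op n e d -> bounded_op n e d' -> bounded_op n e (c *: d + d').
Proof.
move=> [nd ed] [nd' ed']; split; first exact: (diff_le_comb c nd nd').
by move=> m bm; rewrite diffopD diffopZ; apply: deg_leD; [exact: ed|exact: ed'].
Qed.

Lemma bounded_op0 n e : bounded_op n e 0.
Proof. by split=> [|m _]; [exact: diff_le0|rewrite diffop0; exact: deg_le0]. Qed.

Lemma bounded_op_sum n e I (r : seq I) (P : pred I) (F : I -> D) :
  (forall i, P i -> bounded_op n e (F i)) -> bounded_op n e (\sum_(i <- r | P i) F i).
Proof.
move=> XF; elim/big_rec: _ => [|i x Pi Xx]; first exact: bounded_op0.
by rewrite -[F i]scale1r; apply: bounded_op_comb => //; exact: XF.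
Qed.

Lemma bounded_opW n e n' e' d : (n <= n')%N -> (e <= e')%N ->
  bounded_op n e d -> bounded_op n' e' d.
Proof.
move=> nn ee [nd ed]; split; first exact: diff_le_mono nd.
by move=> m /ed; apply: deg_leW; rewrite leq_add2l.
Qed.

Lemma bounded_opM n e n' e' d d' : bounded_op n e d -> bounded_op n' e' d' ->
  bounded_op (n + n') (e + e') (d * d').
Proof.
move=> hd [nd' ed']; split; first by apply: diff_leM => //; case: hd.
move=> m bm; rewrite diffopM addnA addnAC; apply: bounded_op_deg hd _.
exact: ed'.
Qed.

Lemma bounded_op_mulop e f : deg_le e f -> bounded_op 0 e (mulop f).
Proof.
move=> ef; split; first by exists f.
by move=> m bm; rewrite mulopE addnC; apply: deg_leM => //; exact: deg_le_smon.
Qed.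

Lemma bounded_op_bracket n e j d f : deg_le j f -> bounded_op n.+1 e d ->
  bounded_op n (e + j) (d * mulop f - mulop f * d).
Proof.
move=> fj hd; split; first by apply: diff_le_bracket; case: hd.
have hf := bounded_op_mulop fj.
have h1 := bounded_opM hd hf; have h2 := bounded_opM hf hd.
move=> m bm; rewrite diffopB -[_ - _]addrC -scaleN1r; apply: deg_leD.
  by have [_ /(_ m bm)] := h2; rewrite [(j + e)%N]addnC.
by have [_ /(_ m bm)] := h1.
Qed.

(** For a nonzero homogeneous operator of degree $k$ and order $o$, the bounds $k + wo \le t$ and $k
    \ge -o$ give $(w-1)o \le t$, hence $o \le t$; also $k \le t$. *)
Lemma bernstein_bounded w t d : 2 <= w -> bernstein gr w t d -> bounded_op t t d.
Proof.
move=> w2; apply: kspan_min => [{}d [k hk kw]||c u v]; last 2 first.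
- exact: bounded_op0.
- exact: bounded_op_comb.
have [->|d0] := eqVneq d 0; first exact: bounded_op0.
have ge := homog_deg_ge hk (diff_le_ord d) d0.
split; first by apply: diff_le_mono (diff_le_ord d); nia.
move=> m bm m'; move/homog_opP: hk => hk /(hk m bm) e; nia.
Qed.

Lemma bernsteinW w i j d : (i <= j)%N -> bernstein gr w i d -> bernstein gr w j d.
Proof.
move=> ij; apply: kspan_min => [{}d [k hk kw]||c u v]; last 2 first.
- exact: kspan0.
- exact: kspan_comb.
by apply: kspan_sub; exists k => //; lia.
Qed.

Lemma bernstein_homog w (k : int) n i d : 0 <= w ->
  homog_op gr d k -> diff_le n d -> k + w * n%:Z <= i%:Z -> bernstein gr w i d.
Proof.
move=> w0 hk /ord_le nd le; apply: kspan_sub; exists k => //.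
by apply: le_trans le; rewrite lerD2l ler_wpM2l.
Qed.

Lemma homog_opM d (e : D) k l : homog_op gr d k -> homog_op gr e l ->
  homog_op gr (d * e) (k + l).
Proof.
move=> /homog_opP hd /homog_opP he; apply/homog_opP => m bm m'; rewrite diffopM.
by move=> /mcoeff_diffop[m1 [b1 /(he m bm) h1 /(hd m1 b1) ->]]; rewrite h1; lia.
Qed.

Lemma bernsteinM w i j d (e : D) : 0 <= w ->
  bernstein gr w i d -> bernstein gr w j e -> bernstein gr w (i + j) (d * e).
Proof.
move=> w0 hd; move: e; apply: kspan_min => [e [l hl lw]||c u v hu hv]; last 2 first.
- by rewrite mulr0; exact: kspan0.
- by rewrite mulrDr -scalerAr; exact: kspan_comb.
move: d hd; apply: kspan_min => [d [k hk kw]||c u v hu hv]; last 2 first.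
- by rewrite mul0r; exact: kspan0.
- by rewrite mulrDl -scalerAl; exact: kspan_comb.
apply: (bernstein_homog w0 (homog_opM hk hl) (diff_leM (diff_le_ord d) (diff_le_ord e))).
by rewrite !PoszD mulrDr addrACA; exact: lerD.
Qed.

Lemma homog_smon m : balanced m -> homog_op gr (mulop (smon K m)) (xdeg m)%:Z.
Proof.
move=> bm; apply/homog_opP => m1 b1 m'; rewrite mulopE -smonD // val_smon ?balancedD //.
by move=> /mcoeffX_neq0 ->; rewrite xdegD PoszD addrC.
Qed.

Lemma bernstein_smon w m : 0 <= w -> balanced m ->
  bernstein gr w (xdeg m) (mulop (smon K m)).
Proof.
move=> w0 bm; apply: (bernstein_homog w0 (n := 0) (homog_smon bm)).
  by exists (smon K m).
by rewrite mulr0 addr0.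
Qed.

Lemma bernstein1 w : 0 <= w -> bernstein gr w 0 1.
Proof.
by move=> w0; have := bernstein_smon w0 (balanced0 a b); rewrite xdeg0 smon0.
Qed.

End Filtered.

(** If $w < 2$, the elements of degree less than $w$ are constants and generate only constants. *)
Lemma bernstein_slope_ge2 (K : fieldType) (a b : nat) w :
  bernstein_slope (@segre_grading K a.+1 b.+1) w -> 2 <= w.
Proof.
move=> h; rewrite leNgt; apply/negP => w2.
pose T : {pred segre K a.+1 b.+1} := fun f => `[< deg_le 0 f >].
have : sgen K ord0 ord0 \in T.
  have /asboolP := h (sgen K ord0 ord0); apply=> [|f [j fj jw]]; last first.
    by apply/asboolP => m /((segre_gradingP _ _).1 fj); lia.
  split=> [|k u v /asboolP hu /asboolP hv|u v /asboolP hu /asboolP hv]; apply/asboolP.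
  - by rewrite -smon0; apply: deg_le_smon; rewrite xdeg0.
  - exact: deg_leD.
  - exact: (deg_leM hu hv).
have nz : mcoeff (mnmz ord0 ord0) (segre_val (sgen K (@ord0 a) (@ord0 b))) != 0.
  by rewrite val_smon ?balancedz // mcoeffX eqxx oner_eq0.
by move=> /asboolP/(_ _ nz); rewrite !xydegE.
Qed.

(** * The lowering identity *)

Section WeylIdentities.
Variables (K : fieldType) (a b : nat).
Local Notation S := (mpoly (a + b) K).
Local Notation R := (segre K a b).
Local Notation D := (diffop R).
Local Notation mon := (mpolyX K).
Local Notation x i := (mon (mnm1 (lshift b i))).
Local Notation y j := (mon (mnm1 (rshift a j))).
Local Notation dx i := (mderiv (lshift b i)).
Local Notation dy j := (mderiv (rshift a j)).
Implicit Types (p q : S) (f g h : R) (m : multinom (a + b)).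

Definition Ex p := \sum_i x i * dx i p.
Definition Ey p := \sum_j y j * dy j p.

Lemma mon_mnm1_deriv k l : mderiv k (mon (mnm1 l)) = (l == k)%:R :> S.
Proof.
rewrite mderivX mnm1E; case: eqP => [->|_]; last by rewrite scale0r.
by rewrite scale1r (_ : mnm_sub _ _ = mnm0) ?mpolyX0 //; apply/mnmP => i;
  rewrite mnmBE subnn mnm0E.
Qed.

Lemma mon_deriv_mul k m : mon (mnm1 k) * mderiv k (mon m) = (m k)%:R *: mon m :> S.
Proof.
rewrite mderivX -scalerAr -mpolyXD; case: (posnP (m k)) => [->|mk]; first by rewrite !scale0r.
congr (_ *: mon _); rewrite addmC submK //; apply/mnm_lepP => i.
by rewrite mnm1E; case: eqP => [<-|].
Qed.

Lemma ExM p q : Ex (p * q) = Ex p * q + p * Ex q.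
Proof.
rewrite /Ex mulr_suml mulr_sumr -big_split; apply: eq_bigr => i _ /=.
by rewrite mderivM; ring.
Qed.

Lemma EyM p q : Ey (p * q) = Ey p * q + p * Ey q.
Proof.
rewrite /Ey mulr_suml mulr_sumr -big_split; apply: eq_bigr => i _ /=.
by rewrite mderivM; ring.
Qed.

Lemma Ex_dx i p : Ex (dx i p) = dx i (Ex p) - dx i p.
Proof.
rewrite /Ex raddf_sum /= (bigD1 i) //= [in RHS](bigD1 i) //= mderivM mon_mnm1_deriv eqxx.
under [in RHS]eq_bigr => k ki.
  rewrite mderivM mon_mnm1_deriv (inj_eq (@lshift_inj _ _)) (negPf ki) mul0r add0r mderiv_comm.
  over.
by rewrite (_ : true%:R = 1) //; ring.
Qed.

Lemma Ex_dy j p : Ex (dy j p) = dy j (Ex p).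
Proof.
rewrite /Ex raddf_sum /=; apply: eq_bigr => k _.
by rewrite mderivM mon_mnm1_deriv eq_lrshift mul0r add0r mderiv_comm.
Qed.

Lemma Ey_dy i p : Ey (dy i p) = dy i (Ey p) - dy i p.
Proof.
rewrite /Ey raddf_sum /= (bigD1 i) //= [in RHS](bigD1 i) //= mderivM mon_mnm1_deriv eqxx.
under [in RHS]eq_bigr => k ki.
  rewrite mderivM mon_mnm1_deriv (inj_eq (@rshift_inj _ _)) (negPf ki) mul0r add0r mderiv_comm.
  over.
by rewrite (_ : true%:R = 1) //; ring.
Qed.

Lemma Ey_dx j p : Ey (dx j p) = dx j (Ey p).
Proof.
rewrite /Ey raddf_sum /=; apply: eq_bigr => k _.
by rewrite mderivM mon_mnm1_deriv eq_rlshift mul0r add0r mderiv_comm.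
Qed.

Lemma sum_dx_x p : \sum_k dx k (x k * p) = a%:R * p + Ex p.
Proof.
under eq_bigr do rewrite mderivM mon_mnm1_deriv eqxx mul1r.
by rewrite big_split /= sumr_const card_ord mulr_natl.
Qed.

Lemma sum_dy_y p : \sum_k dy k (y k * p) = b%:R * p + Ey p.
Proof.
under eq_bigr do rewrite mderivM mon_mnm1_deriv eqxx mul1r.
by rewrite big_split /= sumr_const card_ord mulr_natl.
Qed.

Lemma Ex_linear : linear Ex.
Proof.
move=> c p q; rewrite /Ex scaler_sumr -big_split; apply: eq_bigr => i _ /=.
by rewrite mderivD mderivZ mulrDr scalerAr.
Qed.

Lemma Ey_linear : linear Ey.
Proof.
move=> c p q; rewrite /Ey scaler_sumr -big_split; apply: eq_bigr => i _ /=.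
by rewrite mderivD mderivZ mulrDr scalerAr.
Qed.

HB.instance Definition _ := GRing.isLinear.Build K S S _ Ex Ex_linear.
HB.instance Definition _ := GRing.isLinear.Build K S S _ Ey Ey_linear.

Lemma Ex_mon m : Ex (mon m) = (xdeg m)%:R *: mon m.
Proof.
by rewrite /xdeg natr_sum scaler_suml; apply: eq_bigr => i _; rewrite mon_deriv_mul.
Qed.

Lemma Ey_mon m : Ey (mon m) = (ydeg m)%:R *: mon m.
Proof.
by rewrite /ydeg natr_sum scaler_suml; apply: eq_bigr => i _; rewrite mon_deriv_mul.
Qed.

Lemma mcoeff_Ex m p : mcoeff m (Ex p) = (xdeg m)%:R * mcoeff m p.
Proof.
rewrite [in LHS](mpolyE p) (linear_sum Ex) (raddf_sum (mcoeff m)).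
rewrite [in RHS](mpolyE p) (raddf_sum (mcoeff m)) mulr_sumr; apply: eq_bigr => m' _.
rewrite linearZ /= Ex_mon !mcoeffZ mcoeffX mulrCA; case: eqP => [->//|_].
by rewrite !mulr0.
Qed.

Lemma ExEy f : Ex (segre_val f) = Ey (segre_val f).
Proof.
rewrite [segre_val f]mpolyE !linear_sum big_seq [RHS]big_seq.
apply: eq_bigr => m /mcoeff_suppP/segre_balanced/eqP bm.
by rewrite !linearZ /= Ex_mon Ey_mon bm.
Qed.

(** Contraction over [k] produces Euler operators: $\sum_k \partial_k x_k = a + E$ in the first sum
    and, because [Ex q = Ey q], again $E q$ in the last one. All terms containing $E q$ then
    cancel. *)
Lemma left_identity i j p q : Ex q = Ey q ->
  \sum_k dx k (dy j (x k * dx i p * q))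
  - (dx i (dy j (p * Ex q)) - p * dx i (dy j (Ex q)))
  + \sum_k y k * dy j p * dx i (dy k q)
  = dy j (dx i (Ex p + (a%:R - 1) * p) * q).
Proof.
move=> e.
have -> : \sum_k dx k (dy j (x k * dx i p * q)) =
    a%:R * dy j (dx i p * q) + dy j ((dx i (Ex p) - dx i p) * q + dx i p * Ex q).
  rewrite -Ex_dx -ExM -Ex_dy -sum_dx_x; apply: eq_bigr => k _.
  by rewrite -mulrA [in LHS]mderivM mon_mnm1_deriv eq_lrshift mul0r add0r.
have -> : \sum_k y k * dy j p * dx i (dy k q) = dy j p * dx i (Ex q).
  rewrite e -Ey_dx mulr_sumr; apply: eq_bigr => k _.
  by rewrite mderiv_comm mulrCA mulrA.
have dC k r : mderiv k (a%:R * r) = a%:R * mderiv k r :> S.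
  by rewrite !mulr_natl mderivMn.
rewrite [(_ - 1) * p]mulrBl mul1r !(dC, mderivN, mderivM, mderivB, mderivD) ![mderiv (lshift b
  i) (dy j _)]mderiv_comm.
by ring.
Qed.

(** The mirror image of [left_identity] under exchange of the two groups of variables. *)
Lemma right_identity i j p q : Ex q = Ey q ->
  \sum_k dx i (dy k (y k * dy j p * q))
  - (dx i (dy j (p * Ex q)) - p * dx i (dy j (Ex q)))
  + \sum_k x k * dx i p * dx k (dy j q)
  = dx i (dy j (Ey p + (b%:R - 1) * p) * q).
Proof.
move=> e.
have -> : \sum_k dx i (dy k (y k * dy j p * q)) =
    b%:R * dx i (dy j p * q) + dx i ((dy j (Ey p) - dy j p) * q + dy j p * Ex q).
  rewrite e -Ey_dy -EyM -Ey_dx -sum_dy_y; apply: eq_bigr => k _.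
  by rewrite mderiv_comm -mulrA [dx i (_ * _)]mderivM mon_mnm1_deriv eq_rlshift mul0r add0r.
have -> : \sum_k x k * dx i p * dx k (dy j q) = dx i p * dy j (Ex q).
  rewrite -Ex_dy mulr_sumr; apply: eq_bigr => k _.
  by rewrite mulrCA mulrA.
have dC k r : mderiv k (b%:R * r) = b%:R * mderiv k r :> S.
  by rewrite !mulr_natl mderivMn.
rewrite [(_ - 1) * p]mulrBl mul1r !(dC, mderivN, mderivM, mderivB, mderivD) ![mderiv (lshift b
  i) (dy j _)]mderiv_comm.
by ring.
Qed.

(** * Operators on the Segre ring induced from the Weyl algebra *)

Definition restr (P : S -> S) f : R := insubd (0 : R) (P (segre_val f)).

Definition preserves (P : S -> S) := forall m, balanced m -> P (mon m) \in @segre_pred K a b.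

(** By linearity it suffices that [P] preserves balanced monomials; the default value [0] in [restr]
    is then never reached. *)
Lemma val_restr (P : S -> S) f : linear P -> preserves P ->
  segre_val (restr P f) = P (segre_val f).
Proof.
move=> linP presP.
rewrite -[LHS]/(val (insubd (0 : R) _)) val_insubd ifT //.
pose PL : {linear S -> S} := HB.pack P (GRing.isLinear.Build _ _ _ _ P linP).
rewrite [segre_val f]mpolyE -[P]/(PL : S -> S) linear_sum big_seq rpred_sum // => m.
by move=> /mcoeff_suppP/segre_balanced/presP; rewrite linearZ /=; exact: rpredZ.
Qed.

Lemma restr_linear (P : S -> S) : linear P -> preserves P -> linear (restr P).
Proof.
move=> linP presP c f g; apply: val_inj; rewrite [RHS]segre_valD segre_valZ.
by rewrite [LHS]val_restr // !val_restr // segre_valD segre_valZ linP.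
Qed.

Definition xd i k p := x i * dx k p.
Definition yd i k p := y i * dy k p.
Definition dd i j p := dx i (dy j p).

Lemma xd_linear i k : linear (xd i k).
Proof. by move=> c p q; rewrite /xd mderivD mderivZ mulrDr scalerAr. Qed.
Lemma yd_linear i k : linear (yd i k).
Proof. by move=> c p q; rewrite /yd mderivD mderivZ mulrDr scalerAr. Qed.
Lemma dd_linear i j : linear (dd i j).
Proof. by move=> c p q; rewrite /dd !(mderivD, mderivZ). Qed.

Lemma mnm_subK k m : (0 < m k)%N -> mnm_add (mnm_sub m (mnm1 k)) (mnm1 k) = m.
Proof. by move=> mk; rewrite submK //; apply/mnm_lepP => i; rewrite mnm1E;
  case: eqP => [<-|]. Qed.

Lemma xd_preserves i k : preserves (xd i k).
Proof.
move=> m /eqP bm; rewrite /xd mderivX -scalerAr -mpolyXD.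
have [->|mk] := posnP (m (lshift b k)); first by rewrite scale0r rpred0.
rewrite rpredZ // mon_segre // /balanced.
by move: bm; rewrite -{1 2}(mnm_subK mk) !xydegE addn1 addn0 add1n add0n => ->.
Qed.

Lemma yd_preserves i k : preserves (yd i k).
Proof.
move=> m /eqP bm; rewrite /yd mderivX -scalerAr -mpolyXD.
have [->|mk] := posnP (m (rshift a k)); first by rewrite scale0r rpred0.
rewrite rpredZ // mon_segre // /balanced.
by move: bm; rewrite -{1 2}(mnm_subK mk) !xydegE addn1 addn0 add1n add0n => ->.
Qed.

Lemma dd_mon i j m : dd i j (mon m) =
  (m (rshift a j) * m (lshift b i))%:R *: mon (mnm_sub (mnm_sub m (mnm1 (rshift a j))) (mnm1
    (lshift b i))).
Proof.
rewrite /dd mderivX mderivZ mderivX mnmBE mnm1E eq_rlshift subn0 scalerA natrM //.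
Qed.

Lemma dd_mon_deg i j m m' : balanced m -> mcoeff m' (dd i j (mon m)) != 0 ->
  balanced m' /\ xdeg m = (xdeg m').+1.
Proof.
move=> bm; rewrite dd_mon mcoeffZ mulf_eq0 negb_or => /andP[mij /mcoeffX_neq0 ->].
have {mij} : (0 < m (rshift a j) * m (lshift b i))%N.
  by rewrite lt0n; apply: contraNneq mij => ->.
rewrite muln_gt0 => /andP[mj mi]; move: bm.
have mi' : (0 < mnm_sub m (mnm1 (rshift a j)) (lshift b i))%N.
  by rewrite mnmBE mnm1E eq_rlshift subn0.
set m2 := mnm_sub _ _.
have mE : m = mnm_add (mnm_add m2 (mnm1 (lshift b i))) (mnm1 (rshift a j)).
  by rewrite !mnm_subK.
have xE : xdeg m = (xdeg m2).+1 by rewrite mE !xydegE; lia.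
have yE : ydeg m = (ydeg m2).+1 by rewrite mE !xydegE; lia.
by rewrite /balanced xE yE eqSS.
Qed.

Lemma dd_preserves i j : preserves (dd i j).
Proof. by move=> m bm; apply/segre_predP => m' /(dd_mon_deg bm)[]. Qed.

Lemma deriv_diff_le (P : S -> S) : linear P -> preserves P ->
  (forall p q, P (p * q) = P p * q + p * P q) -> diff_le 1 (restr P).
Proof.
move=> linP presP PM; split; first exact: restr_linear.
move=> r; exists (restr P r); apply/funext => f /=; apply: val_inj;
  rewrite [LHS]segre_valB [RHS]segre_valM segre_valM.
by rewrite !val_restr // segre_valM PM; ring.
Qed.

Lemma xd_diff_le i k : diff_le 1 (restr (xd i k)).
Proof.
apply: deriv_diff_le; [exact: xd_linear|exact: xd_preserves|].
by move=> p q; rewrite /xd mderivM; ring.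
Qed.

Lemma yd_diff_le i k : diff_le 1 (restr (yd i k)).
Proof.
apply: deriv_diff_le; [exact: yd_linear|exact: yd_preserves|].
by move=> p q; rewrite /yd mderivM; ring.
Qed.

Lemma dd_diff_le i j : diff_le 2 (restr (dd i j)).
Proof.
have ld := dd_linear i j; have pd := @dd_preserves i j.
have lr := restr_linear ld pd.
have brl r : linear (fun f => restr (dd i j) (r * f) - r * restr (dd i j) f).
  by move=> c f g; rewrite lr !mulrDr -!scalerAr lr scalerBr opprD addrACA.
have vE f : segre_val (restr (dd i j) f) = dd i j (segre_val f) by rewrite val_restr.
(* The witness is the double bracket with [r] and [s] applied to 1, where [dd i j] itself
   vanishes. *)
split=> // r; split=> // s; exists (restr (dd i j) (r * s) - r * restr (dd i j) s
   - s * restr (dd i j) r).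
move: (restr (dd i j)) vE {lr brl pd} => P vE.
apply/funext => f /=; apply: val_inj; rewrite [LHS]segre_valB [RHS]segre_valM.
rewrite !segre_valB !segre_valM !segre_valB !vE !segre_valM !vE /dd.
by rewrite !(mderivM, mderivD); ring.
Qed.

Definition xop i k : D := DiffOp (introT (diffop_predP _) (ex_intro _ 1%N (xd_diff_le i k))).
Definition yop i k : D := DiffOp (introT (diffop_predP _) (ex_intro _ 1%N (yd_diff_le i k))).
Definition dop i j : D := DiffOp (introT (diffop_predP _) (ex_intro _ 2%N (dd_diff_le i j))).
Definition euler : D := \sum_i xop i i.

Lemma xopE i k f : segre_val (xop i k f) = x i * dx k (segre_val f).
Proof. by rewrite /= val_restr //; [exact: xd_linear|exact: xd_preserves]. Qed.
Lemma yopE i k f : segre_val (yop i k f) = y i * dy k (segre_val f).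
Proof. by rewrite /= val_restr //; [exact: yd_linear|exact: yd_preserves]. Qed.
Lemma dopE i j f : segre_val (dop i j f) = dx i (dy j (segre_val f)).
Proof. by rewrite /= val_restr //; [exact: dd_linear|exact: dd_preserves]. Qed.
Lemma eulerE f : segre_val (euler f) = Ex (segre_val f).
Proof. by rewrite /euler diffop_sum segre_val_sum; apply: eq_bigr => i _; rewrite xopE. Qed.

Lemma xopM i k f g : xop i k (f * g) = xop i k f * g + f * xop i k g.
Proof.
apply: val_inj; rewrite [RHS]segre_valD !segre_valM [LHS]xopE !xopE segre_valM mderivM.
by ring.
Qed.

Lemma yopM i k f g : yop i k (f * g) = yop i k f * g + f * yop i k g.
Proof.
apply: val_inj; rewrite [RHS]segre_valD !segre_valM [LHS]yopE !yopE segre_valM mderivM.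
by ring.
Qed.

Lemma eulerM f g : euler (f * g) = euler f * g + f * euler g.
Proof.
by apply: val_inj; rewrite [RHS]segre_valD !segre_valM [LHS]eulerE !eulerE segre_valM ExM.
Qed.

(** * The lowering map *)

Definition bracket (u d : D) : D := u * d - d * u.

Lemma bracket_mulop (u : D) g : (forall f, u (g * f) = u g * f + g * u f) ->
  bracket u (mulop g) = mulop (u g).
Proof.
by move=> uM; apply: diffop_eq => f; rewrite diffopB !diffopM !mulopE uM addrK.
Qed.

(** [left_map] and [right_map] are the left-hand sides of the two identities above, with the
    derivatives of [p] replaced by brackets with [d]. They thus make sense for every operator [d],
    and are sandwich maps. *)
Definition left_map i j (d : D) : D :=
  \sum_k dop k j * bracket (xop k i) d - bracket (dop i j) d * euler
  + \sum_k bracket (yop k j) d * dop i k.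
Definition right_map i j (d : D) : D :=
  \sum_k dop i k * bracket (yop k j) d - bracket (dop i j) d * euler
  + \sum_k bracket (xop k i) d * dop k j.

(** Multiplication by $g$ is sent to multiplication by $(E + n - 1) g$. *)
Definition euler_shift (n : nat) (d : D) : D := bracket euler d + (n%:R - 1 : K) *: d.

(* With [G = (E + a - 1) (E + b - 1) g], the three terms are the maps
   [f |-> dy j (dx i G * f)], [f |-> dx i (dy j G * f)] and
   [f |-> dx i (dy j (G * f)) - G * dx i (dy j f)]; by the Leibniz rule only
   multiplication by [dx i (dy j G)] is left. *)
Definition lowering_map i j (d : D) : D :=
  left_map i j (euler_shift b d) + right_map i j (euler_shift a d)
  - bracket (dop i j) (euler_shift a (euler_shift b d)).

Definition shifted n g : R := euler g + (n%:R - 1 : K) *: g.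

Lemma val_shifted n g : segre_val (shifted n g) =
  Ex (segre_val g) + (n%:R - 1) * segre_val g.
Proof.
rewrite segre_valD segre_valZ eulerE; congr (_ + _).
by rewrite -[X in _ = X * _](_ : (n%:R - 1 : K)%:A = _) ?mulr_algl // scalerBl scale1r scaler_nat.
Qed.

Lemma left_map_mulop i j g f : segre_val (left_map i j (mulop g) f) =
  dy j (dx i (segre_val (shifted a g)) * segre_val f).
Proof.
rewrite val_shifted -left_identity ?ExEy // /left_map.
rewrite diffopD diffopB !diffop_sum segre_valD segre_valB !segre_val_sum.
congr (_ - _ + _).
- apply: eq_bigr => k _; rewrite bracket_mulop; last exact: xopM.
  by rewrite diffopM dopE mulopE segre_valM xopE.
- rewrite diffopM diffopB !diffopM !mulopE segre_valB segre_valM !dopE segre_valM eulerE.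
  by rewrite ExEy.
- apply: eq_bigr => k _; rewrite bracket_mulop; last exact: yopM.
  by rewrite diffopM mulopE segre_valM dopE yopE.
Qed.

Lemma right_map_mulop i j g f : segre_val (right_map i j (mulop g) f) =
  dx i (dy j (segre_val (shifted b g)) * segre_val f).
Proof.
rewrite val_shifted [Ex _]ExEy -right_identity ?ExEy // /right_map.
rewrite diffopD diffopB !diffop_sum segre_valD segre_valB !segre_val_sum.
congr (_ - _ + _).
- apply: eq_bigr => k _; rewrite bracket_mulop; last exact: yopM.
  by rewrite diffopM dopE mulopE segre_valM yopE.
- rewrite diffopM diffopB !diffopM !mulopE segre_valB segre_valM !dopE segre_valM eulerE.
  by rewrite ExEy.
- apply: eq_bigr => k _; rewrite bracket_mulop; last exact: xopM.
  by rewrite diffopM mulopE segre_valM dopE xopE.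
Qed.

Lemma euler_shift_mulop n g : euler_shift n (mulop g) = mulop (shifted n g).
Proof.
rewrite /euler_shift bracket_mulop; last exact: eulerM.
by rewrite /shifted linearD linearZ.
Qed.

Lemma shiftedC n n' g : shifted n (shifted n' g) = shifted n' (shifted n g).
Proof.
by rewrite /shifted !diffop_fD !diffop_fZ !scalerDr !scalerA [(n'%:R - 1) * _]mulrC addrACA.
Qed.

Lemma lowering_mulop i j g :
  lowering_map i j (mulop g) = mulop (dop i j (shifted a (shifted b g))).
Proof.
apply: diffop_eq => f; apply: val_inj.
rewrite /lowering_map !euler_shift_mulop diffopB diffopD.
rewrite [LHS]segre_valB segre_valD left_map_mulop right_map_mulop.
rewrite [shifted b (shifted a g)]shiftedC.
rewrite /bracket diffopB !diffopM !mulopE segre_valB [RHS]segre_valM !dopE !segre_valM dopE.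
move: (segre_val (shifted a _)) (segre_val f) => p q.
by rewrite !(mderivM, mderivD) ![dy j (dx i _)]mderiv_comm; ring.
Qed.

End WeylIdentities.

(** * Linear simplicity *)

Section Sandwich.
Variables (K : fieldType) (A : algType K) (B : nat -> set A).
Hypotheses (B1 : B 0%N 1) (BW : forall i j x, (i <= j)%N -> B i x -> B j x)
  (BM : forall i j x y, B i x -> B j y -> B (i + j)%N (x * y))
  (BZ : forall i (c : K) x, B i x -> B i (c *: x)).
Implicit Types (phi psi : A -> A).

(** The pairs do not depend on [d]. The index bounds the left and the right factors separately, so
    costs add under composition. *)
Definition sandwich k phi := exists s : seq (A * A),
  (forall p, p \in s -> B k p.1 /\ B k p.2) /\
  forall d, phi d = \sum_(p <- s) p.1 * d * p.2.

Lemma sandwichW j k phi : (j <= k)%N -> sandwich j phi -> sandwich k phi.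
Proof.
move=> jk [s [sB sE]]; exists s; split=> // p /sB[p1 p2].
by split; apply: BW jk _.
Qed.

Lemma sandwich_id : sandwich 0 id.
Proof.
exists [:: (1, 1)]; split=> [p|d]; last by rewrite big_seq1 mul1r mulr1.
by rewrite inE => /eqP ->.
Qed.

Lemma sandwichD k phi psi : sandwich k phi -> sandwich k psi ->
  sandwich k (fun d => phi d + psi d).
Proof.
move=> [s [sB sE]] [t [tB tE]]; exists (s ++ t); split=> [p|d].
  by rewrite mem_cat => /orP[/sB|/tB].
by rewrite big_cat /= sE tE.
Qed.

Lemma sandwichZ k phi (c : K) : sandwich k phi -> sandwich k (fun d => c *: phi d).
Proof.
move=> [s [sB sE]]; exists [seq (c *: p.1, p.2) | p <- s]; split=> [p|d].
  by move=> /mapP[q /sB[q1 q2] ->]; split=> //; exact: BZ.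
by rewrite big_map sE scaler_sumr; apply: eq_bigr => p _; rewrite /= !scalerAl.
Qed.

Lemma sandwichB k phi psi : sandwich k phi -> sandwich k psi ->
  sandwich k (fun d => phi d - psi d).
Proof.
move=> hp /(sandwichZ (-1)) hq; have [s [sB sE]] := sandwichD hp hq.
by exists s; split=> // d; rewrite -sE scaleN1r.
Qed.

Lemma sandwich0 k : sandwich k (fun _ => 0).
Proof. by exists [::]; split=> // d; rewrite big_nil. Qed.

Lemma sandwich_sum k I (r : seq I) (F : I -> A -> A) :
  (forall i, sandwich k (F i)) -> sandwich k (fun d => \sum_(i <- r) F i d).
Proof.
move=> FB; elim: r => [|i r [t [tB tE]]].
  by have [s [sB sE]] := sandwich0 k; exists s; split=> // d; rewrite big_nil -sE.
have [s [sB sE]] := FB i; exists (s ++ t); split=> [p|d].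
  by rewrite mem_cat => /orP[/sB|/tB].
by rewrite big_cat big_cons /= sE tE.
Qed.

Lemma sandwich_lmul j k u phi : B j u -> sandwich k phi ->
  sandwich (j + k) (fun d => u * phi d).
Proof.
move=> ju [s [sB sE]]; exists [seq (u * p.1, p.2) | p <- s]; split=> [p|d].
  move=> /mapP[q /sB[q1 q2] ->]; split; first exact: BM.
  exact: BW (leq_addl _ _) q2.
by rewrite big_map sE mulr_sumr; apply: eq_bigr => p _; rewrite /= !mulrA.
Qed.

Lemma sandwich_rmul j k u phi : B j u -> sandwich k phi ->
  sandwich (k + j) (fun d => phi d * u).
Proof.
move=> ju [s [sB sE]]; exists [seq (p.1, p.2 * u) | p <- s]; split=> [p|d].
  move=> /mapP[q /sB[q1 q2] ->]; split; last exact: BM.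
  exact: BW (leq_addr _ _) q1.
by rewrite big_map sE mulr_suml; apply: eq_bigr => p _; rewrite /= !mulrA.
Qed.

Lemma sandwich_bracket j k u phi : B j u -> sandwich k phi ->
  sandwich (j + k) (fun d => u * phi d - phi d * u).
Proof.
move=> ju hp; apply: sandwichB; first exact: sandwich_lmul.
by rewrite addnC; exact: sandwich_rmul.
Qed.

Lemma sandwich_comp j k phi psi : sandwich j phi -> sandwich k psi ->
  sandwich (j + k) (phi \o psi).
Proof.
move=> [s [sB sE]] hp.
have [t [tB tE]] : sandwich (j + k) (fun d => \sum_(p <- s) p.1 * psi d * p.2).
  elim: s sB {sE} => [|p s IH] sB.
    have [t [tB tE]] := sandwich0 (j + k).
    by exists t; split=> // d; rewrite big_nil -tE.
  have [p1 p2] := sB p (mem_head _ _).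
  have h : sandwich (j + k) (fun d => p.1 * psi d * p.2).
    have [t [tB tE]] := hp; exists [seq (p.1 * q.1, q.2 * p.2) | q <- t]; split.
      move=> _ /mapP[q /tB[q1 q2] ->]; split; first exact: BM.
      by rewrite /= addnC; exact: BM.
    move=> d; rewrite big_map tE mulr_sumr mulr_suml; apply: eq_bigr => q _ /=.
    by rewrite !mulrA.
  have [|t [tB tE]] := sandwichD h (IH _).
    by move=> q qs; apply: sB; rewrite inE qs orbT.
  by exists t; split=> // d; rewrite big_cons -tE.
by exists t; split=> // d; rewrite /= sE tE.
Qed.

Lemma sandwich_linear k phi : sandwich k phi -> linear phi.
Proof.
move=> [s [_ sE]] c u v; rewrite !sE scaler_sumr -big_split; apply: eq_bigr => p _ /=.
by rewrite mulrDr mulrDl -scalerAr -scalerAl.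
Qed.

End Sandwich.

(** * Carrying a nonzero operator to 1 *)

Section Reduction.
Variables (K : numFieldType) (a b : nat) (w : int).
Hypothesis w2 : 2 <= w.
Local Notation R := (segre K a b).
Local Notation D := (diffop R).
Local Notation B := (bernstein (@segre_grading K a b) w).
Local Notation dx i := (mderiv (lshift b i)).
Local Notation dy j := (mderiv (rshift a j)).
Implicit Types (d : D) (f g : R) (m : multinom (a + b)).

Let w0 : 0 <= w. Proof. exact: le_trans w2. Qed.
Let B1 : B 0%N 1. Proof. exact: bernstein1. Qed.
Let BW i j (x : D) : (i <= j)%N -> B i x -> B j x. Proof. exact: bernsteinW. Qed.
Let BM i j (x y : D) : B i x -> B j y -> B (i + j)%N (x * y).
Proof. exact: bernsteinM. Qed.
Let BZ i (c : K) (x : D) : B i x -> B i (c *: x).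
Proof. by move=> Bx; rewrite -[_ *: _]addr0; apply: kspan_comb => //; exact: kspan0. Qed.

(** Enough for operators of order at most two and degree at most zero. *)
Definition op_cost : nat := 2 * `|w|.

Lemma bernstein_xop i k : B op_cost (xop K b i k).
Proof.
apply: (bernstein_homog (k := 0) (n := 1)) => //; last by rewrite /op_cost; lia.
  apply/homog_opP => m bm m'; rewrite xopE val_smon // mderivX -scalerAr -mpolyXD.
  rewrite mcoeffZ mulf_eq0 negb_or => /andP[mk /mcoeffX_neq0 ->].
  have {mk}mk : (0 < m (lshift b k))%N by rewrite lt0n; apply: contraNneq mk => ->.
  by rewrite -{2}(mnm_subK mk) !xydegE; lia.
exact: xd_diff_le.
Qed.

Lemma bernstein_yop i k : B op_cost (yop K a i k).
Proof.
apply: (bernstein_homog (k := 0) (n := 1)) => //; last by rewrite /op_cost; lia.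
  apply/homog_opP => m bm m'; rewrite yopE val_smon // mderivX -scalerAr -mpolyXD.
  rewrite mcoeffZ mulf_eq0 negb_or => /andP[mk /mcoeffX_neq0 ->].
  have {mk}mk : (0 < m (rshift a k))%N by rewrite lt0n; apply: contraNneq mk => ->.
  by rewrite -{2}(mnm_subK mk) !xydegE; lia.
exact: yd_diff_le.
Qed.

Lemma bernstein_dop i j : B op_cost (dop K i j).
Proof.
apply: (bernstein_homog (k := -1) (n := 2)) => //; last by rewrite /op_cost; lia.
  apply/homog_opP => m bm m'; rewrite dopE val_smon // => /(dd_mon_deg bm)[_ ->].
  by rewrite -[(_.+1)]addn1 PoszD addrK.
exact: dd_diff_le.
Qed.

Lemma bernstein_euler : B op_cost (euler K a b).
Proof. by apply: kspan_sum => i _; exact: bernstein_xop. Qed.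

Lemma bernstein_gen i j : B 1 (mulop (sgen K i j)).
Proof.
have : B _ (mulop (smon K (mnmz i j))) := bernstein_smon _ w0 (balancedz i j).
by rewrite !xydegE.
Qed.

(** Each term composes three operations of cost [op_cost]: a shift, a bracket and a multiplication,
    or two shifts and a bracket. *)
Lemma sandwich_lowering i j : sandwich B (3 * op_cost) (@lowering_map K a b i j).
Proof.
have br u : B op_cost u -> sandwich B op_cost (bracket u).
  by move=> Bu; rewrite -[op_cost]addn0; apply: sandwich_bracket => //; exact: sandwich_id.
have brd := br _ (bernstein_dop i j).
have sh n : sandwich B op_cost (euler_shift (K := K) (a := a) (b := b) n).
  apply: sandwichD; first exact: br bernstein_euler.
  by apply: sandwichZ => //; apply: (sandwichW _ (leq0n _)) => //; exact: sandwich_id.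
have sl : sandwich B (op_cost + op_cost) (@left_map K a b i j).
  apply: sandwichD; [apply: sandwichB => //|]; last 2 first.
  - by apply: sandwich_rmul => //; exact: bernstein_euler.
  - apply: sandwich_sum => k; apply: sandwich_rmul => //; last exact/br/bernstein_yop.
    exact: bernstein_dop.
  apply: sandwich_sum => k; apply: sandwich_lmul => //; last exact/br/bernstein_xop.
  exact: bernstein_dop.
have sr : sandwich B (op_cost + op_cost) (@right_map K a b i j).
  apply: sandwichD; [apply: sandwichB => //|]; last 2 first.
  - by apply: sandwich_rmul => //; exact: bernstein_euler.
  - apply: sandwich_sum => k; apply: sandwich_rmul => //; last exact/br/bernstein_xop.
    exact: bernstein_dop.
  apply: sandwich_sum => k; apply: sandwich_lmul => //; last exact/br/bernstein_yop.
  exact: bernstein_dop.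
rewrite !mulSn mul0n addn0 addnA.
apply: sandwichB => //; first apply: sandwichD.
- exact: (sandwich_comp BM sl (sh b)).
- exact: (sandwich_comp BM sr (sh a)).
- exact: (sandwich_comp BM (sandwich_comp BM brd (sh a)) (sh b)).
Qed.

Lemma mcoeff_shifted n g m : mcoeff m (segre_val (shifted n g)) =
  ((xdeg m)%:R + n%:R - 1) * mcoeff m (segre_val g).
Proof.
rewrite val_shifted mcoeffD mcoeff_Ex.
rewrite (_ : (n%:R - 1) * segre_val g = (n%:R - 1 : K) *: segre_val g) ?mcoeffZ; first by ring.
by rewrite -mulr_algl scalerBl scale1r scaler_nat.
Qed.

(** The integer factor is nonzero in characteristic zero, so a nonconstant [g] is not killed for
    every choice of [i] and [j]. *)
Lemma mcoeff_lowered i j g m : mcoeff m (segre_val (dop K i j (shifted a (shifted b g)))) =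
  ((xdeg m + a) * (xdeg m + b) * (m (rshift a j)).+1 * (m (lshift b i)).+1)%:R
    * mcoeff (mnm_add (mnmz i j) m) (segre_val g).
Proof.
rewrite dopE !mcoeff_mderiv !mcoeff_shifted.
have -> : mnm_add (mnm_add m (mnm1 (lshift b i))) (mnm1 (rshift a j)) = mnm_add (mnmz i j) m.
  by rewrite -addmA addmC.
rewrite xdegD !xydegE mnmDE mnm1E eq_lrshift [(_ + false)%N]addn0 -mulrnA -[LHS]mulr_natl.
by move: (mcoeff _ _) => c; rewrite !natrM !natrD; ring.
Qed.

(** A lowering that does not kill [g] reduces the degree bound by one. If all of them kill [g], then
    [g] is constant already. *)
Lemma mulop_to_one n g : deg_le n g -> g != 0 ->
  exists phi, sandwich B (3 * op_cost * n) phi /\ phi (mulop g) = 1.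
Proof.
elim: n g => [|n IH] g gn g0.
  have gE := deg_le_const gn; set c := mcoeff _ _ in gE.
  have c0 : c != 0 by apply: contraNneq g0 => c0; rewrite gE c0 scale0r.
  exists (fun d => c^-1 *: d); split.
    by rewrite muln0; apply: sandwichZ => //; exact: sandwich_id.
  by rewrite gE linearZ /= scalerA mulVf // scale1r rmorph1.
have [[i [j nz]]|none] :=
    pselect (exists i j, dop K i j (shifted a (shifted b g)) != 0).
  have [|phi [sphi phiE]] := IH _ _ nz.
    move=> m; rewrite mcoeff_lowered mulf_eq0 negb_or => /andP[_ /gn].
    by rewrite xdegD !xydegE.
  exists (phi \o @lowering_map K a b i j); split.
    by rewrite mulnS addnC; apply: (sandwich_comp BM sphi); exact: sandwich_lowering.
  by rewrite /= lowering_mulop.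
have [|phi [sphi phiE]] := IH g _ g0; last first.
  by exists phi; split=> //; apply: sandwichW sphi => //; rewrite leq_mul2l leqnSn orbT.
apply: (deg_leW (leq0n n)) => m nz; rewrite leqNgt; apply/negP => m0.
have [i [j [m' [bm' mE _]]]] := balanced_split (segre_balanced nz) m0.
apply: none; exists i, j; apply: contraTneq nz => z.
have := mcoeff_lowered i j g m'; rewrite z segre_val0 mcoeff0 -mE => /esym/eqP.
rewrite mulf_eq0 => /orP[|/eqP ->]; last by rewrite eqxx.
rewrite pnatr_eq0 !muln_eq0 /= !orbF !addn_eq0.
have a0 : a != 0%N by rewrite -lt0n (leq_trans _ (ltn_ord i)).
have b0 : b != 0%N by rewrite -lt0n (leq_trans _ (ltn_ord j)).
by rewrite (negPf a0) (negPf b0) !andbF.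
Qed.

(** As long as [d] is not a multiplication operator, some bracket with a generator is nonzero; each
    one costs 1, lowers the order bound by one and raises the degree bound by one. *)
Lemma bounded_to_mulop n e d : bounded_op n e d -> d != 0 ->
  exists phi g, [/\ sandwich B n phi, phi d = mulop g, g != 0 & deg_le (e + n) g].
Proof.
elim: n e d => [|n IH] e d hd d0.
  have dE := diff_leP0 hd.1.
  exists id, (d 1); split=> //; first exact: sandwich_id.
    by apply: contraNneq d0 => d1; rewrite dE d1 raddf0.
  rewrite addn0 -smon0 -[e]add0n -(xdeg0 a b); exact: (hd.2 _ (balanced0 a b)).
have [dE|[i [j nz]]] := commute_gens_dec d.
  exists id, (d 1); split=> //.
  - by apply: (sandwichW _ (leq0n _)) => //; exact: sandwich_id.
  - by apply: contraNneq d0 => d1; rewrite dE d1 raddf0.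
  - apply: (deg_leW (leq_addr n.+1 e)).
    by rewrite -smon0 -[e]add0n -(xdeg0 a b); exact: (hd.2 _ (balanced0 a b)).
have dg : deg_le 1 (sgen K i j) by exact: deg_le_gen.
have [phi [g [sphi phiE g0 gn]]] := IH _ _ (bounded_op_bracket dg hd) nz.
exists (phi \o (fun d => d * mulop (sgen K i j) - mulop (sgen K i j) * d)), g; split=> //.
  rewrite -addn1; apply: (sandwich_comp BM sphi).
  apply: sandwichB => //.
    rewrite -[1%N]add0n; apply: sandwich_rmul => //; last exact: sandwich_id.
    exact: bernstein_gen.
  rewrite -[1%N]addn0; apply: sandwich_lmul => //; last exact: sandwich_id.
  exact: bernstein_gen.
by apply: deg_leW gn; rewrite addn1 addSnnS.
Qed.

Lemma bernstein_linearly_simple : linearly_simple B.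
Proof.
(* At most [t] brackets reach multiplication by a function of degree at most [2 * t], which is then
   lowered at cost [3 * op_cost] per degree. *)
exists (1 + 3 * op_cost * 2)%N => t r Br r0.
have [phi [g [sphi phiE g0 gn]]] := bounded_to_mulop (bernstein_bounded w2 Br) r0.
have [psi [spsi psiE]] := mulop_to_one gn g0.
have [s [sB sE]] := sandwich_comp BM spsi sphi.
have : \sum_(p <- s) p.1 * r * p.2 = 1 by rewrite -sE /= phiE.
move=> <-; rewrite big_seq; apply: kspan_sum => p /sB[p1 p2].
apply: kspan_sub; exists p.1, p.2; split=> //.
  by apply: BW p1; nia.
by apply: BW p2; nia.
Qed.

End Reduction.

(** * Separating a large family of operators *)

Section Separation.
Variables (K : numFieldType) (a b : nat) (w : int).
Hypothesis w2 : 2 <= w.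
Local Notation R := (segre K a.+1 b.+1).
Local Notation D := (diffop R).
Local Notation B := (bernstein (@segre_grading K a.+1 b.+1) w).
Local Notation Z := ('I_a.+1 + 'I_b)%type.
Local Notation c := (op_cost w).
Implicit Types (d : D) (f g h : R) (m e : multinom (a.+1 + b.+1)) (l k : Z) (v : Z -> nat).

Let w0 : 0 <= w. Proof. exact: le_trans w2. Qed.
Let B1 : B 0%N 1. Proof. exact: bernstein1. Qed.
Let BW i j (x : D) : (i <= j)%N -> B i x -> B j x. Proof. exact: bernsteinW. Qed.
Let BM i j (x y : D) : B i x -> B j y -> B (i + j)%N (x * y).
Proof. exact: bernsteinM. Qed.
Let BZ i (k : K) (x : D) : B i x -> B i (k *: x).
Proof. by move=> Bx; rewrite -[_ *: _]addr0; apply: kspan_comb => //; exact: kspan0. Qed.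
Let BB i (x y : D) : B i x -> B i y -> B i (x - y).
Proof. by move=> Bx By; rewrite addrC -scaleN1r; exact: kspan_comb. Qed.

(* The monomials [zgen l] are a transcendence basis of the fraction field of
   [R], and [zdiff l] acts on them as the Euler operator of the variable
   [zgen l]. *)
Definition zexp l : multinom (a.+1 + b.+1) :=
  match l with inl i => mnmz i ord0 | inr j => mnmz ord0 (lift ord0 j) end.

Definition zgen l : R := smon K (zexp l).

Definition zdiff l : D :=
  match l with
  | inl i => xop K b.+1 i i -
      (if i == ord0 then \sum_j yop K a.+1 (lift ord0 j) (lift ord0 j) else 0)
  | inr j => yop K a.+1 (lift ord0 j) (lift ord0 j)
  end.

(** The exponent of [zgen l] in [m] over the transcendence basis. Since $x_0$ also divides every
    $z_{0j}$, its exponent has to be corrected when [i] is [ord0]; the result may be negative. *)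
Definition tau l m : K :=
  match l with
  | inl i => (m (lshift b.+1 i))%:R -
      (if i == ord0 then \sum_(j < b) (m (rshift a.+1 (lift ord0 j)))%:R else 0)
  | inr j => (m (rshift a.+1 (lift ord0 j)))%:R
  end.

Lemma balanced_zexp l : balanced (zexp l).
Proof. by case: l => i; exact: balancedz. Qed.

Lemma xdeg_zexp l : xdeg (zexp l) = 1%N.
Proof. by case: l => i; rewrite !xydegE. Qed.

Lemma tauD l m1 m2 : tau l (mnm_add m1 m2) = tau l m1 + tau l m2.
Proof.
case: l => i; rewrite /tau ?mnmDE ?natrD //.
case: ifP => _; last by rewrite !subr0.
by under eq_bigr do rewrite mnmDE natrD; rewrite big_split /= opprD addrACA.
Qed.

Lemma tau_zexp l k : tau l (zexp k) = (k == l)%:R.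
Proof.
have sE (j : 'I_b.+1) : \sum_(j' < b) (mnm1 (rshift a.+1 j) (rshift a.+1 (lift ord0 j')))%:R
    = (j != ord0)%:R :> K.
  case: (unliftP ord0 j) => [j'|] ->.
    rewrite (bigD1 j') //= mnm1E eqxx big1 ?addr0 // => j'' ne.
    by rewrite mnm1E (inj_eq (@rshift_inj _ _)) (inj_eq lift_inj) eq_sym (negPf ne).
  by rewrite big1 // => j' _; rewrite mnm1E (inj_eq (@rshift_inj _ _)).
case: l k => [i|j] [k|k]; rewrite /tau /zexp /mnmz ?mnmDE ?mnm1E ?eq_rlshift ?eq_lrshift.
- rewrite (inj_eq (@lshift_inj _ _)) addn0.
  under eq_bigr do rewrite mnmDE [mnm1 (lshift _ _) _]mnm1E eq_lrshift add0n.
  by rewrite sE eqxx if_same subr0.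
- rewrite (inj_eq (@lshift_inj _ _)) addn0.
  under eq_bigr do rewrite mnmDE [mnm1 (lshift _ _) _]mnm1E eq_lrshift add0n.
  by rewrite sE /= eq_sym; case: (i == ord0); rewrite ?subrr ?subr0.
- by rewrite (inj_eq (@rshift_inj _ _)).
- by rewrite (inj_eq (@rshift_inj _ _)) (inj_eq lift_inj).
Qed.

Lemma zdiff_smon l m : balanced m -> zdiff l (smon K m) = tau l m *: smon K m.
Proof.
move=> bm.
have xE i : xop K b.+1 i i (smon K m) = (m (lshift b.+1 i))%:R *: smon K m.
  by apply: val_inj; rewrite [LHS]xopE [RHS]segre_valZ val_smon // mon_deriv_mul.
have yE j : yop K a.+1 j j (smon K m) = (m (rshift a.+1 j))%:R *: smon K m.
  by apply: val_inj; rewrite [LHS]yopE [RHS]segre_valZ val_smon // mon_deriv_mul.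
case: l => [i|j]; rewrite /zdiff /tau; last exact: yE.
rewrite diffopB xE scalerBl; congr (_ - _); case: ifP => _; last by rewrite scale0r.
by rewrite diffop_sum scaler_suml; apply: eq_bigr => j _; exact: yE.
Qed.

Lemma bernstein_zdiff l : B c (zdiff l).
Proof.
case: l => [i|j] /=; last exact: bernstein_yop.
apply: BB; first exact: bernstein_xop.
case: ifP => _; last exact: kspan0.
by apply: kspan_sum => j _; exact: bernstein_yop.
Qed.

Lemma bernstein_zgen l : B 1 (mulop (zgen l)).
Proof.
have : B _ (mulop (smon K (zexp l))) := bernstein_smon _ w0 (balanced_zexp l).
by rewrite xdeg_zexp.
Qed.

(** Such a [d] is a diagonal operator followed by multiplication by [h]; brackets with the [zgen l]
    keep this form for the operators considered below. *)
Definition acts d (chi : multinom (a.+1 + b.+1) -> K) h :=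
  forall m, balanced m -> d (smon K m) = chi m *: (h * smon K m).

Lemma acts_diag_prod (I : Type) (r : seq I) (F : I -> D) chi :
  (forall i, acts (F i) (chi i) 1) ->
  acts (\prod_(i <- r) F i) (fun m => \prod_(i <- r) chi i m) 1.
Proof.
move=> hF m bm; elim: r => [|i r IH]; first by rewrite !big_nil diffop1 mul1r scale1r.
by rewrite !big_cons diffopM IH diffop_fZ !mul1r hF // mul1r scalerA mulrC.
Qed.

Lemma acts_lmul d chi h g : acts d chi h -> acts (mulop g * d) chi (g * h).
Proof. by move=> hd m bm; rewrite diffopM hd // mulopE -scalerAr mulrA. Qed.

Definition falling n (t : K) : K := \prod_(i < n) (t - i%:R).

(** The forward difference acts on falling factorials as differentiation does on powers. *)
Lemma falling_diff n t : falling n (t + 1) - falling n t = n%:R * falling n.-1 t.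
Proof.
case: n => [|n]; first by rewrite /falling !big_ord0 subrr mul0r.
rewrite /falling big_ord_recl big_ord_recr /= subr0.
have -> : \prod_(i < n) (t + 1 - (lift ord0 i)%:R) = \prod_(i < n) (t - i%:R) :> K.
  by apply: eq_bigr => i _; rewrite /= /bump /= add1n -addn1 natrD; ring.
by rewrite -addn1 natrD; ring.
Qed.

Definition chi (v : Z -> nat) m : K := \prod_l falling (v l) (tau l m).

Definition fdiff (v : Z -> nat) : D :=
  \prod_l \prod_(i < v l) (zdiff l - (i%:R : K) *: 1).

Definition zmon (v : Z -> nat) : R := \prod_l zgen l ^+ v l.

Lemma acts_fdiff v : acts (fdiff v) (chi v) 1.
Proof.
apply: acts_diag_prod => l; apply: acts_diag_prod => i m bm.
by rewrite diffopB zdiff_smon // diffopZ diffop1 mul1r -scalerBl.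
Qed.

Definition zbracket l d : D := d * mulop (zgen l) - mulop (zgen l) * d.

Definition lower l n v : Z -> nat := fun l' => (v l' - (l' == l) * n)%N.

(** Multiplication by [zgen l] shifts [tau l] by one, so the bracket is a forward difference in that
    variable. Truncation in [lower] is harmless: the factor [v l ^_ n] vanishes when [n] exceeds
    [v l]. *)
Lemma acts_zbracket l n v d h (x : K) : acts d (fun m => x * chi v m) h ->
  acts (iter n (zbracket l) d) (fun m => x * (v l ^_ n)%:R * chi (lower l n v) m)
    (zgen l ^+ n * h).
Proof.
move=> hd; elim: n => [|n IH] m bm.
  rewrite [iter _ _ _]/= hd // ffactn0 mulr1 expr0 mul1r; congr (_ * _ *: _).
  by apply: eq_bigr => l' _; rewrite /lower muln0 subn0.
set d' := iter n _ _ in IH; rewrite iterS -/d' /zbracket.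
rewrite diffopB !diffopM !mulopE -smonD ?balanced_zexp // !IH ?balancedD ?balanced_zexp //.
rewrite smonD ?balanced_zexp // -scalerAr exprS -!mulrA.
rewrite -/(zgen l) [h * (zgen l * _)]mulrCA [_ ^+ n * (zgen l * _)]mulrCA.
rewrite -scalerBl; congr (_ *: _).
rewrite -mulrBr; congr (_ * _); rewrite ffactnSr natrM -mulrA -mulrBr; congr (_ * _).
rewrite /chi (bigD1 l) //= [X in _ - X](bigD1 l) //= [in RHS](bigD1 l) //=.
have -> : \prod_(i | i != l) falling (lower l n v i) (tau i (mnm_add (zexp l) m)) =
    \prod_(i | i != l) falling (lower l n v i) (tau i m).
  by apply: eq_bigr => i il; rewrite tauD tau_zexp eq_sym (negPf il) add0r.
have -> : \prod_(i | i != l) falling (lower l n.+1 v i) (tau i m) =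
    \prod_(i | i != l) falling (lower l n v i) (tau i m).
  by apply: eq_bigr => i il; rewrite /lower (negPf il) !mul0n.
rewrite -mulrBl mulrA; congr (_ * _).
rewrite tauD tau_zexp eqxx [true%:R + _]addrC [_ + true%:R](_ : _ = tau l m + 1) //.
rewrite falling_diff /lower eqxx !mul1n.
by rewrite subnS.
Qed.

Lemma chi_ext v v' m : v =1 v' -> chi v m = chi v' m.
Proof. by move=> e; apply: eq_bigr => l _; rewrite e. Qed.

Definition zbrackets v (s : seq Z) d : D := foldr (fun l => iter (v l) (zbracket l)) d s.

Lemma acts_zbrackets v0 v (s : seq Z) d h : uniq s -> acts d (chi v) h ->
  acts (zbrackets v0 s d)
    (fun m => (\prod_(l <- s) (v l ^_ v0 l)%:R) *
       chi (fun l => v l - (l \in s) * v0 l)%N m)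
    ((\prod_(l <- s) zgen l ^+ v0 l) * h).
Proof.
elim: s => [|l s IH] /= us hd m bm.
  rewrite !big_nil !mul1r hd //; congr (_ *: _); apply: chi_ext => l.
  by rewrite mul0n subn0.
move: us => /andP[ls us]; have /= h1 := @acts_zbracket l (v0 l) _ _ _ _ (IH us hd).
rewrite h1 // !big_cons (negPf ls) mul0n subn0 [X in X * chi _ _]mulrC -!mulrA.
congr (_ * (_ * _) *: _); apply: chi_ext => l'; rewrite /lower in_cons.
by case: eqP => [->|_]; rewrite ?(negPf ls) ?mul0n ?mul1n ?subn0.
Qed.

Lemma sandwich_zbrackets v (s : seq Z) :
  sandwich B (\sum_(l <- s) v l) (zbrackets v s).
Proof.
elim: s => [|l s IH]; first by rewrite big_nil; exact: sandwich_id.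
rewrite big_cons /=; have : sandwich B (v l) (iter (v l) (zbracket l)).
  elim: (v l) => [|n IHn]; first exact: sandwich_id.
  suff hz : sandwich B 1 (zbracket l) by exact: (sandwich_comp BM hz IHn).
  apply: sandwichB => //.
    rewrite -[1%N]add0n; apply: sandwich_rmul => //; last exact: sandwich_id.
    exact: bernstein_zgen.
  rewrite -[1%N]addn0; apply: sandwich_lmul => //; last exact: sandwich_id.
  exact: bernstein_zgen.
by move=> h; exact: (sandwich_comp BM h IH).
Qed.

Lemma zmonP v (s : seq Z) : exists e, [/\ balanced e,
  \prod_(l <- s) zgen l ^+ v l = smon K e,
  forall k, tau k e = \sum_(l <- s) (l == k)%:R * (v l)%:R
  & xdeg e = (\sum_(l <- s) v l)%N].
Proof.
have t0 k : tau k mnm0 = 0.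
  by apply: (addrI (tau k mnm0)); rewrite -tauD add0m addr0.
have pow l n : exists e, [/\ balanced e, zgen l ^+ n = smon K e,
    forall k, tau k e = (l == k)%:R * n%:R & xdeg e = n].
  elim: n => [|n [e [be zE tE xE]]].
    exists mnm0; split; rewrite ?balanced0 ?smon0 ?xdeg0 // => k.
    by rewrite mulr0.
  exists (mnm_add (zexp l) e); split; first by rewrite balancedD ?balanced_zexp.
  - by rewrite exprS zE smonD ?balanced_zexp.
  - by move=> k; rewrite tauD tau_zexp tE -[n.+1]add1n natrD mulrDr mulr1.
  - by rewrite xdegD xdeg_zexp xE.
elim: s => [|l s [e [be zE tE xE]]].
  exists mnm0; split; rewrite ?big_nil ?balanced0 ?smon0 ?xdeg0 // => k.
  by rewrite big_nil.
have [e' [be' zE' tE' xE']] := pow l (v l).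
exists (mnm_add e' e); split; first by rewrite balancedD.
- by rewrite big_cons zE zE' smonD.
- by move=> k; rewrite big_cons tauD tE tE'.
- by rewrite big_cons xdegD xE xE'.
Qed.

Lemma zmon_smon v : exists e, [/\ balanced e, zmon v = smon K e,
  forall k, tau k e = (v k)%:R & xdeg e = (\sum_l v l)%N].
Proof.
have [e [be zE tE xE]] := zmonP v (index_enum Z); exists e; split=> // k.
rewrite tE (bigD1 k) //= eqxx mul1r big1 ?addr0 // => l lk.
by rewrite (negPf lk) mul0r.
Qed.

(** Applied to multiplication by [zmon v], a pair [(l, n)] contributes the factor [v l - n], and so
    kills the monomials of exponent [n] at [l]. *)
Definition eigen_filter (s : seq (Z * nat)) d : D :=
  foldr (fun p x => bracket (zdiff p.1) x - (p.2%:R : K) *: x) d s.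

Lemma eigen_filter_zmon s v (x : K) : eigen_filter s (x *: mulop (zmon v)) =
  (x * \prod_(p <- s) ((v p.1)%:R - p.2%:R)) *: mulop (zmon v).
Proof.
have [e [be zE tE _]] := zmon_smon v.
have step l n (y : K) : bracket (zdiff l) (y *: mulop (zmon v)) - (n%:R : K) *: (y *: mulop
  (zmon v))
    = (y * ((v l)%:R - n%:R)) *: mulop (zmon v).
  apply: diffop_ext => m bm; rewrite zE diffopB /bracket diffopB !diffopM !diffopZ !mulopE.
  rewrite -smonD // diffop_fZ !zdiff_smon ?balancedD // -scalerAr -smonD //.
  rewrite tauD tE; rewrite !scalerA -!scalerBl; congr (_ *: _); ring.
elim: s => [|p s IH]; first by rewrite big_nil mulr1.
by rewrite /= IH step big_cons -mulrA [X in (_ * X)]mulrC.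
Qed.

Lemma sandwich_eigen_filter s : sandwich B (size s * c) (eigen_filter s).
Proof.
elim: s => [|p s IH]; first exact: sandwich_id.
rewrite /= mulSn; apply: sandwichB => //.
  by apply: sandwich_bracket => //; exact: bernstein_zdiff.
by apply: sandwichZ => //; apply: sandwichW IH => //; exact: leq_addl.
Qed.

(** * The separated family *)

Section Family.
Variable q : nat.
Local Notation I := ({ffun Z -> 'I_q} * {ffun Z -> 'I_q})%type.
Implicit Types (i : I) (J : {pred I}).

Definition zop i : D := mulop (zmon (fun l => i.1 l)) * fdiff (fun l => i.2 l).

Lemma card_zop_index : #|{: I}| = (q ^ (a + b).+1 * q ^ (a + b).+1)%N.
Proof. by rewrite card_prod card_ffun card_sum !card_ord. Qed.

Lemma sum_family (v : {ffun Z -> 'I_q}) : (\sum_l v l <= (a + b).+1 * q)%N.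
Proof.
have -> : ((a + b).+1 = \sum_(l : Z) 1)%N by rewrite sum1_card card_sum !card_ord.
by rewrite big_distrl /=; apply: leq_sum => l _; rewrite mul1n ltnW.
Qed.

Lemma bernstein_zop i : B ((1 + c) * (a + b).+1 * q) (zop i).
Proof.
rewrite -mulnA mulnDl mul1n; apply: BM.
  have [e [be -> _ xE]] := zmon_smon (fun l => i.1 l).
  by apply: BW (bernstein_smon _ w0 be); rewrite xE sum_family.
have prodB (T : Type) (r : seq T) (F : T -> D) (n : T -> nat) :
    (forall t, B (c * n t) (F t)) -> B (c * \sum_(t <- r) n t) (\prod_(t <- r) F t).
  move=> FB; elim: r => [|t r IH]; first by rewrite !big_nil muln0.
  by rewrite !big_cons mulnDr; apply: BM.
apply: (BW (i := c * \sum_l i.2 l)); first by rewrite leq_mul2l sum_family orbT.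
apply: (prodB _ _ _ (fun l => nat_of_ord (i.2 l))) => l;
  rewrite -[X in (c * X)%N]card_ord -sum1_card; apply: prodB => j.
rewrite muln1; apply: BB; first exact: bernstein_zdiff.
by apply: BZ; exact: BW B1.
Qed.

(** For each variable and each unit of [q]: 1 for the brackets, [2 * c] for the filter and [6 * c]
    for the final lowering to 1. *)
Definition separation_cost : nat := ((a + b).+1 * (1 + 8 * c))%N.

(* Brackets with the [zgen l] kill every [zop i] whose second exponent is not
   the chosen maximal one and turn the others into monomials, among which
   [eigen_filter] selects one. *)
Lemma separate J i1 : i1 \in J -> exists i0 phi, [/\ i0 \in J,
  sandwich B (separation_cost * q) phi & forall i, i \in J -> phi (zop i) = (i == i0)%:R].
Proof.
move=> Ji1; case: (@arg_maxnP _ i1 (mem J) (fun i => (\sum_l i.2 l)%N) Ji1) => i0 Ji0 max.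
pose u0 := i0.1; pose g0 := i0.2.
pose psi1 := zbrackets (fun l => g0 l) (index_enum Z).
pose x := \prod_l ((g0 l) ^_ (g0 l))%:R : K.
have psi1E i : i \in J ->
    psi1 (zop i) = (if i.2 == g0 then x else 0) *: mulop (zmon (fun l => i.1 l + g0 l)%N).
  move=> Ji; have h1 := acts_lmul (zmon (fun l => i.1 l)) (acts_fdiff (fun l => i.2 l)).
  have h2 := acts_zbrackets (fun l => g0 l) (index_enum_uniq Z) h1.
  have zE : \prod_(l <- index_enum Z) zgen l ^+ g0 l * (zmon (fun l => i.1 l) * 1) =
      zmon (fun l => i.1 l + g0 l)%N.
    by rewrite mulr1 /zmon -big_split; apply: eq_bigr => l _; rewrite /= -exprD addnC.
  apply: diffop_ext => m bm; rewrite [LHS]h2 // diffopZ mulopE zE.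
  congr (_ *: _); case: eqP => [->|/eqP ne].
    rewrite (chi_ext _ (v' := fun=> 0%N)) /chi => [|l];
      last by rewrite mem_index_enum mul1n subnn.
    by rewrite [X in _ * X]big1 ?mulr1 // => l _; rewrite /falling big_ord0.
  (* The sum of [g0] is maximal and [i.2] differs from [g0], so [i.2] is smaller in some coordinate,
     where the falling factorial vanishes. *)
  have [l lt] : exists l, (i.2 l < g0 l)%N.
    apply/existsP; apply: contraNT ne => /existsPn ge.
    have ge' l : (g0 l <= i.2 l)%N by rewrite leqNgt ge.
    have : (\sum_l i.2 l <= \sum_l g0 l)%N := max i Ji.
    rewrite leq_eqVlt => /orP[/eqP e|lt]; last first.
      by move: lt; rewrite ltnNge leq_sum.
    apply/eqP/ffunP => l; apply/val_inj/eqP; rewrite eqn_leq ge' andbT leqNgt.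
    apply/negP => lt; move: e; apply/eqP; rewrite neq_ltn orbC.
    rewrite (bigD1 l) //= [X in (_ < X)%N](bigD1 l) //= -addSn leq_add //.
    by rewrite leq_sum.
  by rewrite (bigD1 l) //= ffact_small // !mul0r.
have x0 : x != 0.
  by apply/prodf_neq0 => l _; rewrite ffactnn pnatr_eq0 -lt0n fact_gt0.
pose v0 l := (u0 l + g0 l)%N.
(* All exponents [i.1 l + g0 l] are below [2 * q]; the filter lists every value except the correct
   one [v0 l]. *)
pose s := [seq p <- allpairs pair (index_enum Z) (iota 0 (2 * q)) | p.2 != v0 p.1].
pose y v : K := \prod_(p <- s) ((v p.1)%:R - p.2%:R).
have y0 : y v0 != 0.
  rewrite prodf_seq_neq0; apply/allP => p; rewrite mem_filter => /andP[ne _].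
  by rewrite subr_eq0 eqr_nat eq_sym.
have yE i : i.2 = g0 -> i != i0 -> y (fun l => i.1 l + g0 l)%N = 0.
  move=> i2 ne; have [l ul] : exists l, i.1 l != u0 l.
    apply/existsP; apply: contraNT ne => /existsPn h.
    have e : i.1 = u0 by apply/ffunP => l; apply/eqP/negPn/h.
    by rewrite (surjective_pairing i) e i2 -surjective_pairing.
  apply/eqP; rewrite prodf_seq_eq0; apply/hasP; exists (l, i.1 l + g0 l)%N;
    last by rewrite subrr eqxx.
  rewrite mem_filter /= /v0 eqn_add2r ul /=; apply/allpairsP.
  exists (l, (i.1 l + g0 l)%N); split=> //; rewrite ?mem_index_enum // mem_iota /= add0n.
  by rewrite mul2n -addnn -addSn leq_add // ltnW.
have [e [be zE _ xE]] := zmon_smon v0.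
(* The surviving monomial is lowered to 1. *)
have [psi3 [spsi3 psi3E]] : exists phi, sandwich B (3 * c * \sum_l v0 l) phi /\
    phi (mulop (zmon v0)) = 1.
  apply: mulop_to_one => //; first by rewrite zE; apply: deg_le_smon; rewrite xE.
  apply/eqP => z0.
  have : mcoeff e (segre_val (zmon v0)) = 1 by rewrite zE val_smon // mcoeffX eqxx.
  by rewrite z0 segre_val0 mcoeff0 => /esym/eqP; rewrite oner_eq0.
exists i0, (fun d => (x * y v0)^-1 *: (psi3 \o (eigen_filter s \o psi1)) d); split=> //.
  apply: sandwichZ => //; apply: (@sandwichW _ _ _ BW
    (3 * c * (2 * ((a + b).+1 * q)) + (((a + b).+1 * (2 * q)) * c + (a + b).+1 * q))%N).
    by rewrite /separation_cost; nia.
  apply: (sandwich_comp BM); last apply: (sandwich_comp BM).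
  - apply: sandwichW spsi3 => //; rewrite leq_mul2l /v0 big_split mul2n -addnn leq_add ?orbT //.
      exact: sum_family.
    exact: sum_family.
  - apply: sandwichW (sandwich_eigen_filter s) => //; rewrite leq_mul2r orbC.
    rewrite size_filter (leq_trans (count_size _ _)) // size_allpairs size_iota leq_mul2r.
    by rewrite -[index_enum _]enumT -cardE card_sum !card_ord leqnn orbT.
  - apply: sandwichW (sandwich_zbrackets _ _) => //; exact: sum_family.
move=> i Ji /=; rewrite psi1E // eigen_filter_zmon -/(y _).
have lin3 := sandwich_linear spsi3.
have psi3Z (k : K) d : psi3 (k *: d) = k *: psi3 d.
  have z0 : psi3 0 = 0 by have := lin3 (-1) 0 0; rewrite scaleN1r oppr0 addr0 scaleN1r addNr.
  by rewrite -[k *: d]addr0 lin3 z0 addr0.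
have [->|ne] := eqVneq i i0.
  by rewrite eqxx psi3Z psi3E scalerA mulVf ?mulf_neq0 // scale1r.
case: ifP => [/eqP i2|_]; last by rewrite mul0r psi3Z scale0r scaler0.
by have := yE i i2 ne; rewrite /y => ->; rewrite mulr0 psi3Z scale0r scaler0.
Qed.

End Family.

End Separation.

(** * Krull dimension *)

Section Coordinates.
Variables (K : fieldType) (a b : nat).
Local Notation R := (segre K a.+1 b.+1).
Local Notation Z := ('I_a.+1 + 'I_b)%type.
Implicit Types (f : R) (m : multinom (a.+1 + b.+1)).

(* All exponents but that of [y_0]; they determine a balanced monomial. *)
Definition code m (l : Z) : nat :=
  match l with inl i => m (lshift b.+1 i) | inr j => m (rshift a.+1 (lift ord0 j)) end.

Lemma code_inj m1 m2 : balanced m1 -> balanced m2 -> code m1 =1 code m2 -> m1 = m2.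
Proof.
move=> /eqP b1 /eqP b2 e.
have ex i : m1 (lshift b.+1 i) = m2 (lshift b.+1 i) := e (inl i).
have ey j : m1 (rshift a.+1 (lift ord0 j)) = m2 (rshift a.+1 (lift ord0 j)) := e (inr j).
have ed : ydeg m1 = ydeg m2 by rewrite -b1 -b2; apply: eq_bigr => i _.
apply/mnmP => k; rewrite -(splitK k); case: (fintype.split k) => [i|j] /=; first exact: ex.
case: (unliftP ord0 j) => [j'|] ->; first exact: ey.
move: ed; rewrite /ydeg !big_ord_recl.
by under eq_bigr do rewrite ey; move=> /addIn.
Qed.

Lemma code_le m l : balanced m -> (code m l <= xdeg m)%N.
Proof.
move=> /eqP bm; case: l => [i|j] /=.
  by rewrite /xdeg (bigD1 i) //= leq_addr.
by rewrite bm /ydeg (bigD1 (lift ord0 j)) //= leq_addr.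
Qed.

(** Codes of no balanced monomial get [mnm0]; only surjectivity onto the balanced monomials of
    degree below [N] is needed. *)
Definition decode_mnm N (g : {ffun Z -> 'I_N}) : multinom (a.+1 + b.+1) :=
  xget mnm0 [set m | balanced m /\ forall l, code m l = g l].

Lemma decode_mnm_onto N m : balanced m -> (xdeg m < N)%N ->
  exists g : {ffun Z -> 'I_N}, decode_mnm g = m.
Proof.
move=> bm mN; have lt l : (code m l < N)%N by apply: leq_ltn_trans mN; exact: code_le.
exists [ffun l => Ordinal (lt l)]; rewrite /decode_mnm.
case: xgetP => [m' _ [bm' h]|none].
  by apply: code_inj => // l; rewrite h ffunE.
by exfalso; apply: (none m); split=> // l; rewrite ffunE.
Qed.

Lemma coordinates_eq0 d N f : deg_le d f -> (d < N)%N ->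
  (forall g : {ffun Z -> 'I_N}, mcoeff (decode_mnm g) (segre_val f) = 0) -> f = 0.
Proof.
move=> fd dN h; apply: val_inj; rewrite [val 0]segre_val0; apply/mpolyP => m.
rewrite mcoeff0; apply/eqP; apply: contraT => nz.
have [g gm] := decode_mnm_onto (segre_balanced nz) (leq_ltn_trans (fd _ nz) dN).
by move: nz; rewrite -gm h eqxx.
Qed.

(** * Polynomial relations and chains of primes *)

Fixpoint words N n : seq (seq nat) :=
  if n is n'.+1 then allpairs cons (iota 0 N) (words N n') else [:: [::]].

Lemma size_words N n : size (words N n) = (N ^ n)%N.
Proof. by elim: n => //= n IH; rewrite size_allpairs size_iota IH expnS. Qed.

Lemma words_uniq N n : uniq (words N n).
Proof.
elim: n => //= n IH; apply: allpairs_uniq => //; first exact: iota_uniq.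
by move=> [x s] [y t] _ _ /= [-> ->].
Qed.

Definition word_monomial (fs : seq R) (s : seq nat) : R :=
  foldr (fun p x => p.1 ^+ p.2 * x) 1 (zip fs s).

Definition word_eval N fs (c : seq nat -> K) : R :=
  \sum_(s <- words N (size fs)) c s *: word_monomial fs s.

Lemma word_eval_cons N f fs c : word_eval N (f :: fs) c =
  \sum_(j < N) f ^+ j * word_eval N fs (fun s => c (nat_of_ord j :: s)).
Proof.
rewrite /word_eval /= big_flatten big_map -[X in iota 0 X]subn0 -/(index_iota 0 N) big_mkord.
apply: eq_bigr => j _; rewrite big_map mulr_sumr; by apply: eq_bigr => s _; rewrite -scalerAr.
Qed.

(** In a relation modulo [P k], the lowest power of [f] can be cancelled, as [f] lies outside the
    prime [P k]. Since [f] is in [P k.+1], the lowest coefficient is then a relation modulo [P k.+1]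
    among the remaining elements. *)
Lemma prime_chain_independent (P : nat -> {pred R}) N fs k c :
  (forall i, (i <= k + size fs)%N -> prime_ideal (P i)) ->
  (forall i, (i < size fs)%N -> {subset P (k + i)%N <= P (k + i).+1} /\
     (nth 0 fs i \in P (k + i).+1 /\ nth 0 fs i \notin P (k + i)%N)) ->
  word_eval N fs c \in P k -> forall s, s \in words N (size fs) -> c s = 0.
Proof.
elim: fs k c => [|f fs IH] k c prP chP evP s /=.
  have [[_ P1 PD] _] := prP k (leq_addr _ _).
  rewrite inE => /eqP ->; apply/eqP; apply: contraNT P1 => c0.
  move: evP; rewrite /word_eval big_seq1 /word_monomial /= => h.
  have /= := PD ((c [::])^-1)%:A _ 0 h.
  rewrite addr0 mulr_algl scalerA mulVf // scale1r; apply.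
  by case: (prP k (leq_addr _ _)) => -[].
have [[P0 P1 PD] Pm] := prP k (leq_addr _ _).
have [sub0 [fP' fP]] := chP 0%N (ltn0Sn _); rewrite !addn0 in sub0 fP' fP.
have [|[P0' P1' PD'] _] := prP k.+1; first by rewrite /= addnS ltnS leq_addr.
have PX n x : f ^+ n * x \in P k -> x \in P k.
  elim: n x => [|n IHn] x; first by rewrite mul1r.
  by rewrite exprS -mulrA => /Pm; rewrite (negPf fP) /=; exact: IHn.
have key j t : (j < N)%N -> t \in words N (size fs) -> c (j :: t) = 0.
  have [n] := ubnP j; elim: n j t => // n IHn j t jn jN.
  move: t; apply: (IH k.+1 (fun t => c (j :: t))).
  - by move=> i le; apply: prP; rewrite /= addnS -addSn.
  - by move=> i lt; have := chP i.+1; rewrite /= addnS -addSn; apply.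
  move: evP; rewrite word_eval_cons (bigD1 (Ordinal jN)) //=.
  set gj := word_eval _ _ _; move=> evP.
  (* Terms with a lower power of [f] vanish by induction; those with a higher one are divisible by
     [f ^+ j.+1]. *)
  have [h hE] : exists h, \sum_(i < N | i != Ordinal jN)
      f ^+ i * word_eval N fs (fun s => c (nat_of_ord i :: s)) = f ^+ j * (f * h).
    exists (\sum_(i < N | i != Ordinal jN)
      f ^+ (i - j.+1) * word_eval N fs (fun s => c (nat_of_ord i :: s))).
    rewrite !mulr_sumr; apply: eq_bigr => i ij.
    have [lt|ge] := ltnP i j.
      rewrite (_ : word_eval _ _ _ = 0) ?mulr0 //.
      rewrite /word_eval big_seq big1 // => u us.
      by rewrite (IHn i u _ _ us) ?scale0r // (leq_trans lt).
    rewrite !mulrA -exprSr -exprD subnKC //.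
    by rewrite ltn_neqAle ge andbT eq_sym; apply: contraNneq ij => e; apply/eqP/val_inj.
  move: evP; rewrite hE -mulrDr => /PX /sub0 gP.
  have -> : gj = - h * f + (gj + f * h) by rewrite mulNr [h * f]mulrC addrCA addNr addr0.
  exact: PD'.
by move=> /allpairsP[[j t] /= [jN ts ->]]; apply: key => //; move: jN; rewrite mem_iota.
Qed.

Lemma deg_le_word_monomial d N n fs s : (forall f, f \in fs -> deg_le d f) ->
  (size fs <= n)%N -> all (fun j => (j < N)%N) s -> deg_le (n * (N * d)) (word_monomial fs s).
Proof.
have deg1 k : deg_le k (1 : R) by rewrite -smon0; apply: deg_le_smon; rewrite xdeg0.
elim: fs n s => [|f fs IH] [|n] [|j s] fsd //= szn; rewrite /word_monomial /=;
  try by move=> _; exact: deg1.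
move=> /andP[jN sN]; rewrite mulSn; apply: deg_leM; last first.
  by apply: IH => // g gf; apply: fsd; rewrite inE gf orbT.
apply: (deg_leW (d := j * d)); first by rewrite leq_mul2r ltnW ?orbT.
by apply: deg_leX; apply: fsd; rewrite inE eqxx.
Qed.

Lemma words_lt N n s : s \in words N n -> all (fun j => (j < N)%N) s.
Proof.
elim: n s => [|n IH] s /=; first by rewrite inE => /eqP ->.
by move=> /allpairsP[[j t] /= [jN /IH tN ->]] /=; rewrite tN andbT; move: jN; rewrite mem_iota.
Qed.

(** With exponents below [N] there are [N ^ n.+1] words, while their values have degree linear in
    [N] and so only about [N ^ n] coefficients. *)
Lemma algebraic_dependence fs : size fs = (a + b).+2 ->
  exists N c, word_eval N fs c = 0 /\ exists2 s, s \in words N (size fs) & c s != 0.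
Proof.
move=> szf; set n := (a + b).+1 in szf *.
have [d fsd] : exists d, forall f, f \in fs -> deg_le d f.
  elim: fs {szf} => [|f fs [d IH]]; first by exists 0%N.
  have [d' fd'] := deg_le_exists f; exists (maxn d d') => g.
  rewrite inE => /orP[/eqP ->|/IH]; [move: fd'|]; apply: deg_leW.
    exact: leq_maxr.
  exact: leq_maxl.
(* Here [X <= N * A] and [A ^ n < N], whence [X ^ n < N ^ n.+1]. *)
pose A := (n.+1 * d).+1; pose N := (A ^ n).+1; pose X := (n.+1 * (N * d)).+1.
have XE : (X ^ n < N ^ n.+1)%N.
  apply: (@leq_ltn_trans ((N * A) ^ n)%N).
    by rewrite leq_exp2r // /X /A mulnS [(n.+1 * (N * d))%N]mulnCA -add1n leq_add2r.
  by rewrite expnMn expnSr ltn_pmul2l ?expn_gt0.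
pose W := words N (size fs).
have [|c [i0 ci0] cE] := @left_kernel K 'I_(size W) {ffun Z -> 'I_X}
    (fun i g => mcoeff (decode_mnm g) (segre_val (word_monomial fs (nth [::] W i)))).
  by rewrite card_ffun card_sum !card_ord size_words szf addSn.
pose c' s := if insub (index s W) is Some i then c i else 0.
have c'E (i : 'I_(size W)) : c' (nth [::] W i) = c i.
  rewrite /c' index_uniq ?words_uniq // insubT // => h; congr c; exact: val_inj.
exists N, c'; split; last by exists (nth [::] W i0); rewrite ?mem_nth ?c'E.
have deg : deg_le (n.+1 * (N * d)) (word_eval N fs c').
  rewrite /word_eval big_seq; elim/big_rec: _ => [|s x sW xd]; first exact: deg_le0.
  apply: deg_leD => //; apply: deg_le_word_monomial => //; first by rewrite szf.
  exact: words_lt sW.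
apply: (coordinates_eq0 deg (ltnSn _)) => g.
rewrite -[RHS](cE g) /word_eval -/W segre_val_sum raddf_sum (big_nth [::]) big_mkord.
by apply: eq_bigr => i _; rewrite /= mcoeffZ c'E.
Qed.

(** A longer chain, with one element chosen in each step [P i.+1] outside [P i], would give too many
    independent elements. *)
Lemma krull_dim_segre (Re : realType) : (krull_dim Re R <= ((a + b).+1)%:R%:E)%E.
Proof.
apply: ub_ereal_sup => _ [m [P [prP chP]] <-]; rewrite lee_fin ler_nat leqNgt.
apply/negP => nm; pose n := (a + b).+1.
have /choice[x xP] (i : nat) : exists x, (i < m)%N -> x \in P i.+1 /\ x \notin P i.
  case: (ltnP i m) => [/chP[_ [x x1 x2]]|_]; last by exists 0.
  by exists x.
pose fs := mkseq x n.+1.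
have [|N [c [cE [s sW cs]]]] := @algebraic_dependence fs; first by rewrite size_mkseq.
move: cs; rewrite (@prime_chain_independent P N fs 0 c _ _ _ s sW) ?eqxx //.
- by move=> i; rewrite size_mkseq add0n => le; apply: prP; apply: leq_trans le nm.
- move=> i; rewrite size_mkseq => lt; rewrite add0n nth_mkseq //.
  have im : (i < m)%N by apply: leq_trans lt nm.
  by split; [case: (chP i im)|apply: xP].
- by rewrite cE; have [[]] := prP 0%N (leq0n _).
Qed.

End Coordinates.

(** * Growth of modules *)

(** A copy of [M] that can carry its second module structure, over [K] through [k%:A]. *)
Definition kmod (K : fieldType) (A : algType K) (M : lmodType A) : Type := M.

Section KMod.
Variables (K : fieldType) (A : algType K) (M : lmodType A).

HB.instance Definition _ := GRing.Zmodule.copy (kmod M) M.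

Definition kscale (k : K) (u : kmod M) : kmod M := (k%:A : A) *: (u : M).

Lemma kscaleA k l u : kscale k (kscale l u) = kscale (k * l) u.
Proof. by rewrite /kscale scalerA -scalerAl mul1r scalerA. Qed.

Lemma kscale1 : left_id 1 kscale.
Proof. by move=> u; rewrite /kscale !scale1r. Qed.

Lemma kscaleDr : right_distributive kscale +%R.
Proof. by move=> k u v; rewrite /kscale scalerDr. Qed.

Lemma kscaleDl u : {morph kscale^~ u : k l / k + l}.
Proof. by move=> k l; rewrite /kscale !scalerDl. Qed.

HB.instance Definition _ := GRing.Zmodule_isLmodule.Build K (kmod M)
  kscaleA kscale1 kscaleDr kscaleDl.

Lemma saturated0 : saturated [set (0 : kmod M)].
Proof.
split=> [//|k u v -> ->|k u k0 /= u0]; first by rewrite /= scaler0 addr0.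
by rewrite -[u]scale1r -(mulVf k0) -scalerA u0 scaler0.
Qed.

Lemma free_mod_kfree n (v : 'I_n -> kmod M) : free_mod [set 0] v -> kfree (v : 'I_n -> M).
Proof. by move=> fv c c0; apply: fv. Qed.

End KMod.

Section ModuleGrowth.
Variables (K : numFieldType) (a b : nat) (w : int).
Hypothesis w2 : 2 <= w.
Local Notation R := (segre K a.+1 b.+1).
Local Notation D := (diffop R).
Local Notation B := (bernstein (@segre_grading K a.+1 b.+1) w).
Local Notation sc := (separation_cost a b w).
Local Notation zc := ((1 + op_cost w) * (a + b).+1)%N.

Let w0 : 0 <= w. Proof. exact: le_trans w2. Qed.

Lemma filtrationW (M : lmodType D) (F : nat -> set M) i j u :
  compatible_filtration B F -> (i <= j)%N -> F i u -> F j u.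
Proof.
move=> [_ FS _ _] /subnKC <-; elim: (j - i)%N => [|k IH]; first by rewrite addn0.
by move=> /IH; rewrite addnS; exact: FS.
Qed.

(** If a nonzero combination of the [zop p] killed [F (sc * q + j0)], a separating sandwich map
    would turn it into a nonzero scalar killing [m0]: its right factors send [m0] into that space.
    So [free_mod_exists] applies to the action of the [zop p]. *)
Lemma kfree_exists (M : lmodType D) (F : nat -> set M) (q j0 : nat) (m0 : M) :
  compatible_filtration B F -> F j0 m0 -> m0 != 0 ->
  exists v : 'I_(q ^ (a + b).+1) -> M,
    (forall i, F ((zc + sc) * q + j0)%N (v i)) /\ kfree v.
Proof.
move=> cF Fm0 m00; have FW := filtrationW cF; have [Fsub _ _ BF] := cF.
pose I := ({ffun ('I_a.+1 + 'I_b) -> 'I_q} * {ffun ('I_a.+1 + 'I_b) -> 'I_q})%type.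
have [| | | | | |v [Fv fv]] := @free_mod_exists K (kmod M) [set 0]
  (F (sc * q + j0)%N) (F ((zc + sc) * q + j0)%N) I
  (fun i u => (zop K i : D) *: (u : M)) (q ^ (a + b).+1) (@saturated0 _ _ M).
- move=> p k u v; rewrite /= scalerDr; congr (_ + _).
  rewrite -[k *: u]/((k%:A : D) *: (u : M)) -[RHS]/((k%:A : D) *: _) !scalerA.
  by rewrite mulr_algl mulr_algr.
- by move=> p u -> /=; rewrite scaler0.
- by move=> u; apply: FW; rewrite mulnDl -addnA leq_addl.
- move=> p u Fu; rewrite mulnDl -addnA; apply: BF => //.
  exact: bernstein_zop.
- move=> x [p xp].
  have [i0 [phi [xi0 [s [sB sE]] phiE]]] := @separate K a b w w2 q (fun p => x p != 0) p xp.
  apply: contrapT => none.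
  have none' u : F (sc * q + j0)%N u -> \sum_p (x p)%:A *: ((zop K p : D) *: u) = 0.
    by move=> Fu; apply: contrapT => nz; apply: none; exists u.
  have [s' sE'] : exists d : D, d = \sum_p x p *: zop K p by exists (\sum_p x p *: zop K p).
  have phid : phi s' = x i0 *: 1.
    have lin := sandwich_linear (ex_intro _ s (conj sB sE)).
    have phi0 : phi 0 = 0.
      by have := lin (-1) 0 0; rewrite scaleN1r oppr0 addr0 scaleN1r addNr.
    have -> : phi s' = \sum_p x p *: phi (zop K p).
      rewrite sE'; elim/big_rec2: _ => [//|p' y1 y2 _ <-].
      by rewrite lin.
    rewrite (bigD1 i0) //= phiE // eqxx big1 ?addr0 // => p' ne.
    have [->|xp'] := eqVneq (x p') 0; first by rewrite scale0r.
    by rewrite phiE // (negPf ne) scaler0.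
  have /eqP[] := m00; have : (x i0 *: (1 : D)) *: m0 = 0.
    rewrite -phid sE scaler_suml big_seq big1 // => p' /sB[p1 p2].
    rewrite -!scalerA sE' scaler_suml.
    rewrite [X in _ *: X](_ : _ = \sum_p (x p)%:A *: ((zop K p : D) *: (p'.2 *: m0))).
      by rewrite none' ?scaler0 //; exact: BF.
    by apply: eq_bigr => p'' _; rewrite [RHS]scalerA mulr_algl.
  move=> xm0; rewrite -[m0]scale1r -[X in X *: _](_ : (x i0)^-1 *: (x i0 *: (1 : D)) = 1).
    by rewrite -[_^-1 *: _]mulr_algl -scalerA xm0 scaler0.
  by rewrite scalerA mulVf // scale1r.
- by rewrite card_zop_index.
by exists v; split; [exact: Fv|exact: (free_mod_kfree fv)].
Qed.

Lemma Dim_ge (Re : realType) (M : lmodType D) (F : nat -> set M) :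
  (exists m : M, m != 0) -> compatible_filtration B F ->
  (((a + b).+1)%:R%:E <= Dim Re F)%E.
Proof.
move=> [m0 m00] cF; have [_ _ Fcup _] := cF.
have [j0 _ Fm0] : (\bigcup_i F i) m0 by rewrite Fcup.
apply: le_ereal_inf_tmp => _ [t [t0 cvg0] <-]; rewrite lee_fin leNgt; apply/negP => tn.
set n := (a + b).+1 in tn *; pose C1 := (zc + sc + j0)%N.
have C10 : (0 < C1)%N by rewrite /C1 /separation_cost; nia.
pose eps : Re := (C1%:R `^ t)^-1.
have eps0 : 0 < eps by rewrite invr_gt0 powR_gt0 // ltr0n.
have : \forall k \near \oo, (kdim Re (F k) * ((k%:R `^ t)^-1)%:E < eps%:E)%E.
  by apply: (cvg0 (fun y => (y < eps%:E)%E)); apply: open_ereal_lt'; rewrite lte_fin.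
(* This [q] pushes [k] beyond [N]. As [k <= C1 * q] and [t < n], the quotient is at least
   [q ^ n / (C1 * q) ^ t >= eps]. *)
move=> [N _ hN]; pose q := N.+1; pose k := ((zc + sc) * q + j0)%N.
have Nk : (N <= k)%N by rewrite /k /q /separation_cost; nia.
have kC : (k <= C1 * q)%N by rewrite /k /C1 /q; nia.
have k0 : (0 < k)%N by rewrite /k /q /separation_cost; nia.
have := hN k Nk; apply/negP; rewrite -leNgt.
have [v [Fv fv]] := kfree_exists q cF Fm0 m00.
apply: (@le_trans _ _ ((q ^ n)%:R%:E * ((k%:R `^ t)^-1)%:E)%E); last first.
  apply: lee_wpmul2r; first by rewrite lee_fin invr_ge0 powR_ge0.
  by apply: ereal_sup_ubound; exists (q ^ n)%N => //; exists v.
rewrite -EFinM lee_fin ler_pdivlMr ?powR_gt0 ?ltr0n //.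
apply: (@le_trans _ _ (eps * (C1 * q)%:R `^ t)).
  rewrite ler_pM2l //; apply: ge0_ler_powR => //; rewrite ?nnegrE ?ler0n //.
  by rewrite ler_nat.
rewrite natrM powRM ?ler0n // mulrA mulVf ?gt_eqF ?powR_gt0 ?ltr0n // mul1r.
rewrite natrX -powR_mulrn ?ler0n //; apply: ler_powR; first by rewrite ler1n.
exact: ltW.
Qed.

End ModuleGrowth.

(** * Sandwich Bernstein-Sato polynomials *)

(* A polynomial [p] in [s] acts on the term of index
   [n] by [p(n)]. *)
Definition opseq (K : fieldType) (R : comAlgType K) : Type := nat -> diffop R.

Section OpSeq.
Variables (K : fieldType) (R : comAlgType K).
Local Notation D := (diffop R).

HB.instance Definition _ := GRing.Zmodule.copy (opseq R) (nat -> diffop R).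

Definition seq_scale (p : {poly K}) (u : opseq R) : opseq R := fun n => p.[n%:R] *: u n.

Lemma seq_scaleA p p' u : seq_scale p (seq_scale p' u) = seq_scale (p * p') u.
Proof. by apply/funext => n; rewrite /seq_scale hornerM scalerA. Qed.

Lemma seq_scale1 : left_id 1 seq_scale.
Proof. by move=> u; apply/funext => n; rewrite /seq_scale hornerE scale1r. Qed.

Lemma seq_scaleDr : right_distributive seq_scale +%R.
Proof. by move=> p u v; apply/funext => n; exact: scalerDr. Qed.

Lemma seq_scaleDl u : {morph seq_scale^~ u : p p' / p + p'}.
Proof. by move=> p p'; apply/funext => n; rewrite /seq_scale hornerD scalerDl. Qed.

HB.instance Definition _ := GRing.Zmodule_isLmodule.Build {poly K} (opseq R)
  seq_scaleA seq_scale1 seq_scaleDr seq_scaleDl.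

Implicit Types (u v : opseq R) (d : D) (f : R) (s : seq ({poly D} * {poly D})).

Lemma opseqZ (p : {poly K}) u n : (p *: u) n = p.[n%:R] *: u n. Proof. by []. Qed.
Lemma opseqD u v n : (u + v) n = u n + v n. Proof. by []. Qed.
Lemma opseq0 n : (0 : opseq R) n = 0. Proof. by []. Qed.

Lemma opseq_sum (I : Type) (r : seq I) (P : pred I) (F : I -> opseq R) n :
  (\sum_(i <- r | P i) F i) n = \sum_(i <- r | P i) F i n.
Proof. by elim/big_rec2: _ => // i x y _ <-. Qed.

Definition sandwich_expr s f (j n : nat) : D :=
  \sum_(p <- s) p.1.[n%:R] * mulop (f ^+ (n + j)) * p.2.[n%:R].

Definition opow f j : opseq R := fun n => mulop (f ^+ (n + j)).

(** Stands for $D(s) f^{s+j} D(s)$ over the rational functions in $s$: the factor [c] clears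
    denominators and makes the module saturated. *)
Definition sandwich_module f j : set (opseq R) := [set u | exists (c : {poly K}) s,
  c != 0 /\ forall n, c.[n%:R] *: u n = sandwich_expr s f j n].

Lemma comm_nat (d : D) (n : nat) : GRing.comm d n%:R.
Proof. exact: commr_nat. Qed.

Lemma sandwich_expr_lmul (q : {poly D}) s : exists s', forall f j n,
  sandwich_expr s' f j n = q.[n%:R] * sandwich_expr s f j n.
Proof.
exists [seq (q * p.1, p.2) | p <- s] => f j n; rewrite /sandwich_expr big_map mulr_sumr.
apply: eq_bigr => p _; rewrite /= hornerM_comm; last exact/commr_sym/comm_nat.
by rewrite !mulrA.
Qed.

Lemma sandwich_expr_rmul d s : exists s', forall f j n,
  sandwich_expr s' f j n = sandwich_expr s f j n * d.
Proof.
exists [seq (p.1, p.2 * d%:P) | p <- s] => f j n; rewrite /sandwich_expr big_map mulr_suml.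
apply: eq_bigr => p _; rewrite /= hornerM_comm; last exact/commr_sym/comm_nat.
by rewrite hornerC !mulrA.
Qed.

Lemma sandwich_exprZ (c : {poly K}) s : exists s', forall f j n,
  sandwich_expr s' f j n = c.[n%:R] *: sandwich_expr s f j n.
Proof.
have [s' sE] := sandwich_expr_lmul (map_poly (in_alg D) c) s; exists s' => f j n.
by rewrite sE -[n%:R](rmorph_nat (in_alg D)) horner_map mulr_algl.
Qed.

Lemma sandwich_expr_cat s s' f j n :
  sandwich_expr (s ++ s') f j n = sandwich_expr s f j n + sandwich_expr s' f j n.
Proof. exact: big_cat. Qed.

Lemma sandwich_module_saturated f j : saturated (sandwich_module f j).
Proof.
split.
- exists 1, [::]; split; first exact: oner_neq0.
  by move=> n; rewrite /sandwich_expr big_nil scaler0.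
- move=> p u v [c [s [c0 cE]]] [c' [s' [c0' cE']]].
  have [s1 s1E] := sandwich_exprZ (c' * p) s; have [s2 s2E] := sandwich_exprZ c s'.
  exists (c * c'), (s1 ++ s2); split; first by rewrite mulf_neq0.
  move=> n; rewrite sandwich_expr_cat s1E s2E -cE -cE' opseqD opseqZ scalerDr !scalerA.
  by rewrite !hornerM; congr (_ *: _ + _); ring.
- move=> p u p0 [c [s [c0 cE]]]; exists (c * p), s; split; first by rewrite mulf_neq0.
  by move=> n; rewrite -cE opseqZ hornerM scalerA.
Qed.

Lemma sandwich_module_lmul f j d u : sandwich_module f j u ->
  sandwich_module f j (fun n => d * u n).
Proof.
move=> [c [s [c0 cE]]]; have [s' sE] := sandwich_expr_lmul d%:P s.
by exists c, s'; split=> // n; rewrite sE -cE hornerC scalerAr.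
Qed.

Lemma sandwich_module_rmul f j d u : sandwich_module f j u ->
  sandwich_module f j (fun n => u n * d).
Proof.
move=> [c [s [c0 cE]]]; have [s' sE] := sandwich_expr_rmul d s.
by exists c, s'; split=> // n; rewrite sE -cE scalerAl.
Qed.

Lemma opow_sandwich_module f j : sandwich_module f j (opow f j).
Proof.
exists 1, [:: (1, 1)]; split; first exact: oner_neq0.
by move=> n; rewrite /sandwich_expr big_seq1 /= -!polyC1 !hornerC mul1r mulr1 scale1r.
Qed.

(** The extra factors $f$ are absorbed by the operators on the right. *)
Lemma sandwich_moduleW f i j u : (i <= j)%N ->
  sandwich_module f j u -> sandwich_module f i u.
Proof.
move=> /subnKC <-; elim: (j - i)%N u => [|k IH] u; first by rewrite addn0.
move=> [c [s [c0 cE]]]; apply: IH; exists c, [seq (p.1, (mulop f)%:P * p.2) | p <- s].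
split=> // n; rewrite cE /sandwich_expr big_map; apply: eq_bigr => p _ /=.
by rewrite hornerCM !addnS exprSr rmorphM /= !mulrA.
Qed.

(** The polynomial $p(s - j)$, written out by coefficients since [D] is not commutative. *)
Definition poly_shift (p : {poly D}) (j : nat) : {poly D} :=
  \sum_(i < size p) (p`_i)%:P * ('X - (j%:R)%:P) ^+ i.

Lemma poly_shiftE p j n : (j <= n)%N -> (poly_shift p j).[n%:R] = p.[(n - j)%:R].
Proof.
move=> jn; rewrite /poly_shift horner_sum [RHS]horner_coef; apply: eq_bigr => i _.
rewrite hornerCM horner_exp_comm ?hornerXsubC ?natrB //.
by rewrite /comm_poly hornerXsubC; apply: commrB; [exact: commr_refl|exact: comm_nat].
Qed.

Definition root_poly (j : nat) : {poly K} := \prod_(i < j) ('X - (i%:R)%:P).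

Lemma root_poly_neq0 j : root_poly j != 0.
Proof. by apply/prodf_neq0 => i _; rewrite polyXsubC_eq0. Qed.

Lemma root_poly_eq0 j n : (n < j)%N -> (root_poly j).[n%:R] = 0.
Proof.
by move=> nj; rewrite /root_poly horner_prod (bigD1 (Ordinal nj)) //= hornerXsubC subrr mul0r.
Qed.

(** Otherwise the substitution of $s - j$ for $s$ would give a nonzero sandwich equation for [f];
    [root_poly] takes care of the indices below [j]. *)
Lemma opow_notin f j : sandwich_bs f = 0 -> ~ sandwich_module f j.+1 (opow f j).
Proof.
move=> bs0 [c [s [c0 cE]]].
pose c' := c \Po ('X - (j%:R)%:P).
have c0' : c' != 0 by rewrite -size_poly_eq0 size_comp_poly2 ?size_XsubC // size_poly_eq0.
have [s' sE] := sandwich_exprZ (root_poly j) [seq (poly_shift p.1 j, poly_shift p.2 j) | p <- s].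
have eqf : sandwich_eq f (root_poly j * c').
  exists s' => n; have := sE f 1%N n; rewrite {1}/sandwich_expr addn1 => ->.
  rewrite hornerM -scalerA; have [nj|jn] := ltnP n j.
    by rewrite root_poly_eq0 // !scale0r.
  congr (_ *: _); rewrite horner_comp hornerXsubC -natrB //.
  have := cE (n - j)%N; rewrite /opow subnK // => ->.
  rewrite /sandwich_expr big_map; apply: eq_bigr => p _ /=.
  by rewrite !poly_shiftE // [(n - j + _)%N]addnS subnK // addn1.
have := ((sandwich_bsP f).2 _).1 eqf; rewrite bs0 dvd0p mulf_eq0.
by rewrite (negPf (root_poly_neq0 j)) (negPf c0').
Qed.

End OpSeq.

(** * Growth of the sandwich layers *)

Section SandwichGrowth.
Variables (K : numFieldType) (a b : nat).
Local Notation R := (segre K a.+1 b.+1).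
Local Notation D := (diffop R).
Local Notation B := (bernstein (@segre_grading K a.+1 b.+1) 2).
Local Notation sc := (separation_cost a b 2).
Local Notation zc := ((1 + op_cost 2) * (a + b).+1)%N.
Local Notation Z := ('I_a.+1 + 'I_b)%type.
Local Notation I q := ({ffun Z -> 'I_q} * {ffun Z -> 'I_q})%type.
Implicit Types (f : R) (d : D).

Definition sandwich_layer f j t : set (opseq R) := [set u | exists d e,
  [/\ B t d, B t e & u = (fun n => d * mulop (f ^+ (n + j)) * e)]].

Lemma layer_sandwich_module f j t u : sandwich_layer f j t u -> sandwich_module f j u.
Proof.
move=> [d [e [_ _ ->]]]; apply: (@sandwich_module_rmul _ _ f j e (fun n => d * _)).
exact/sandwich_module_lmul/opow_sandwich_module.
Qed.

(** [free_mod_exists] is applied to the maps multiplying by one [zop] on each side. If a nonzero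
    combination sent the layer of index [sc * q] into the next module, separation on the left and
    then on the right would put a nonzero multiple of $f^{s+j}$ there, hence $f^{s+j}$ itself. *)
Lemma sandwich_layer_free f j q : ~ sandwich_module f j.+1 (opow f j) ->
  exists v : 'I_(q ^ (a + b).+1 * q ^ (a + b).+1) -> opseq R,
    (forall i, sandwich_layer f j ((zc + sc) * q) (v i)) /\
    free_mod (sandwich_module f j.+1) v.
Proof.
move=> notin; have sat := sandwich_module_saturated f j.+1; have [_ _ Nsat] := sat.
have BM i k (x y : D) : B i x -> B k y -> B (i + k)%N (x * y) by exact: bernsteinM.
have BW i k (x : D) : (i <= k)%N -> B i x -> B k x by exact: bernsteinW.
pose T (p : I q * I q) (u : opseq R) : opseq R := fun n => zop K p.1 * u n * zop K p.2.
apply: (@free_mod_exists {poly K} (opseq R) _ (sandwich_layer f j (sc * q)) _ _ T) => //.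
- move=> p k u v; apply/funext => n; rewrite /T !opseqD !opseqZ mulrDr mulrDl.
  by rewrite -scalerAr -scalerAl.
- move=> p u Nu; apply: (@sandwich_module_rmul _ _ f j.+1 _ (fun n => _ * u n)).
  exact: sandwich_module_lmul.
- move=> u [d [e [Bd Be ->]]]; exists d, e; split=> //; apply: BW _ _; try eassumption.
    by rewrite leq_mul2r leq_addl orbT.
  by rewrite leq_mul2r leq_addl orbT.
- move=> p u [d [e [Bd Be ->]]]; exists (zop K p.1 * d), (e * zop K p.2); split.
  + by rewrite mulnDl; apply: BM => //; exact: bernstein_zop.
  + by rewrite mulnDl addnC; apply: BM => //; exact: bernstein_zop.
  + by apply/funext => n; rewrite /T !mulrA.
- move=> x [[p1 p2] xp]; apply: contrapT => none.
  have {}none u : sandwich_layer f j (sc * q) u -> sandwich_module f j.+1 (\sum_p x p *: T p u).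
    by move=> Gu; apply: contrapT => h; apply: none; exists u.
  pose J1 i := [exists k, x (i, k) != 0].
  have Jp1 : J1 p1 by apply/existsP; exists p2.
  have [i0 [phi [/existsP[k1 xk1] [s [sB sE]] phiE]]] := @separate K a b 2 isT q J1 p1 Jp1.
  have assoc (y1 y2 y3 y4 y5 y6 : D) :
      y1 * (y2 * (y3 * y4 * y5) * y6) = y1 * y2 * y3 * y4 * y5 * y6 by rewrite !mulrA.
  (* Separation on the left keeps only the left index [i0] and replaces [zop K i0] by 1; [e] stays
     free for the separation on the right. *)
  have step1 e : B (sc * q) e -> sandwich_module f j.+1
      (fun n => \sum_k (x (i0, k)).[n%:R] *: (mulop (f ^+ (n + j)) * e * zop K k)).
    move=> Be; have : sandwich_module f j.+1 (\sum_(p <- s | p \in s)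
        (1 : {poly K}) *: ((fun n => p.1 *
           (\sum_r x r *: T r (fun n => p.2 * mulop (f ^+ (n + j)) * e)) n) : opseq R)).
      apply: saturated_sum => // p /sB[Bp1 Bp2].
      by apply/sandwich_module_lmul/none; exists p.2, e.
    congr sandwich_module; apply/funext => n.
    rewrite opseq_sum -big_seq.
    transitivity (\sum_i \sum_k (x (i, k)).[n%:R] *:
        (phi (zop K i) * mulop (f ^+ (n + j)) * e * zop K k)).
      under eq_bigr => p _.
        rewrite scale1r opseq_sum mulr_sumr.
        under eq_bigr => r _ do rewrite opseqZ /T -scalerAr assoc.
        over.
      rewrite exchange_big pair_bigA /=; apply: eq_bigr => -[i k] _ /=.
      by rewrite -scaler_sumr -!mulr_suml -sE.
    rewrite (bigD1 i0) //= [X in _ + X]big1 ?addr0 => [|i ne].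
      by apply: eq_bigr => k _; rewrite phiE ?eqxx ?mul1r //; apply/existsP; exists k1.
    rewrite big1 // => k _; have [->|nz] := eqVneq (x (i, k)) 0.
      by rewrite horner0 scale0r.
    rewrite phiE ?(negPf ne) ?mul0r ?scaler0 //; apply/existsP; by exists k.
  have [k0 [psi [xk0 [s' [sB' sE']] psiE]]] :=
    @separate K a b 2 isT q (fun k => x (i0, k) != 0) k1 xk1.
  have assoc' (y1 y2 y3 y4 : D) : y1 * y2 * y3 * y4 = y1 * (y2 * y3 * y4) by rewrite !mulrA.
  apply: notin; apply: (Nsat (x (i0, k0))) => //.
  have : sandwich_module f j.+1 (\sum_(p <- s' | p \in s')
      (1 : {poly K}) *: ((fun n => (\sum_k (x (i0, k)).[n%:R] *:
         (mulop (f ^+ (n + j)) * p.1 * zop K k)) * p.2) : opseq R)).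
    apply: saturated_sum => // p /sB'[Bp1 Bp2].
    exact/(@sandwich_module_rmul _ _ f j.+1 p.2 (fun n => \sum_k _))/step1.
  congr sandwich_module; apply/funext => n.
  rewrite opseq_sum -big_seq opseqZ /opow.
  under eq_bigr => p _.
    rewrite scale1r mulr_suml.
    under eq_bigr => k _ do rewrite -scalerAl assoc'.
    over.
  rewrite exchange_big /=.
  under eq_bigr => k _.
    rewrite -scaler_sumr -mulr_sumr -sE'.
    over.
  rewrite (bigD1 k0) //= psiE // eqxx mulr1 big1 ?addr0 // => k ne.
  have [->|nz] := eqVneq (x (i0, k)) 0; first by rewrite horner0 scale0r.
  by rewrite psiE // (negPf ne) mulr0 scaler0.
- by rewrite card_prod card_zop_index leqnn.
Qed.

(** * Normal form of the layers and the rank bound *)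

Definition fbracket f d : D := d * mulop f - mulop f * d.

(** Moving one [f] to the left replaces [A i] by [f * A i + A i.+1]; Pascal's rule collects the
    terms. *)
Lemma mulop_pow_right f d N : d * mulop (f ^+ N) =
  \sum_(i < N.+1) ('C(N, i)%:R : K) *: (mulop (f ^+ (N - i)) * iter i (fbracket f) d).
Proof.
pose A i := iter i (fbracket f) d; rewrite -[d]/(A 0%N).
have AS i : A i * mulop f = mulop f * A i + A i.+1 by rewrite /A iterS /fbracket addrC subrK.
elim: N => [|N IH]; first by rewrite big_ord1 expr0 rmorph1 mulr1 mul1r scale1r.
rewrite exprSr rmorphM /= mulrA IH mulr_suml.
transitivity (\sum_(i < N.+1) ('C(N, i)%:R : K) *: (mulop (f ^+ (N.+1 - i)) * A i) +
    \sum_(i < N.+1) ('C(N, i)%:R : K) *: (mulop (f ^+ (N - i)) * A i.+1)).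
  rewrite -big_split; apply: eq_bigr => i _ /=.
  rewrite -scalerAl -mulrA AS mulrDr mulrA -rmorphM -exprSr scalerDr.
  by rewrite -subSn // -ltnS.
rewrite [RHS]big_ord_recl /=.
under [in RHS]eq_bigr => i _ do rewrite /bump /= add1n binS natrD scalerDl subSS.
rewrite [X in _ = _ + X]big_split /= addrA; congr (_ + _).
rewrite [in LHS]big_ord_recl /= !bin0; congr (_ + _).
rewrite [RHS]big_ord_recr /= bin_small // scale0r addr0.
by apply: eq_bigr => i _; rewrite /bump /= add1n subSS.
Qed.

Lemma fbracket_bounded f d e t i : deg_le e f -> bounded_op t t d -> (i <= t)%N ->
  bounded_op (t - i) (t + i * e) (iter i (fbracket f) d).
Proof.
move=> fe hd; elim: i => [|i IH] it; first by rewrite subn0 mul0n addn0.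
rewrite iterS mulSn addnCA addnA [(e + t)%N]addnC -addnA addnCA addnC.
apply: bounded_op_bracket => //; rewrite -subSn // subSS; apply: IH; exact: ltnW.
Qed.

Lemma fbracket_eq0 f d t i : bounded_op t t d -> (t < i)%N -> iter i (fbracket f) d = 0.
Proof.
move=> hd; have [e fe] := deg_le_exists f.
have /diff_leP0 h : diff_le 0 (iter t (fbracket f) d).
  by have [] := fbracket_bounded fe hd (leqnn t); rewrite subnn.
move=> /subnKC <-; elim: (i - t.+1)%N => [|k IH].
  by rewrite addn0 iterS h /fbracket mulopC subrr.
by rewrite addnS iterS IH /fbracket mul0r mulr0 subrr.
Qed.

(** The binomial coefficient of $s + j$ over $i$ as a polynomial in $s$. *)
Definition binomial_poly (j i : nat) : {poly K} :=
  (i`!%:R)^-1 *: \prod_(l < i) ('X + (j%:R - l%:R)%:P).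

Lemma binomial_polyE j i n : (binomial_poly j i).[n%:R] = 'C(n + j, i)%:R.
Proof.
rewrite hornerZ horner_prod.
have -> : \prod_(l < i) ('X + (j%:R - l%:R)%:P).[n%:R] = ((n + j) ^_ i)%:R :> K.
  under eq_bigr do rewrite hornerD hornerX hornerC addrA -natrD.
  elim: i => [|i IH]; first by rewrite big_ord0.
  rewrite big_ord_recr /= IH ffactnSr natrM; have [le|lt] := leqP i (n + j).
    by rewrite natrB.
  by rewrite ffact_small // !mul0r.
by rewrite -bin_ffact natrM mulrC mulfK // pnatr_eq0 -lt0n fact_gt0.
Qed.

(** Iterated brackets beyond the order [t] vanish, so $f^{n-t}$ splits off on the left and the rest
    is polynomial in $n$. The bounds do not depend on [j]. *)
Lemma layer_normal_form f e j t u : deg_le e f -> (j <= t)%N -> sandwich_layer f j t u ->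
  exists A : 'I_t.+1 -> D, (forall i, bounded_op (2 * t) (2 * t + 2 * t * e) (A i)) /\
    forall n, (t <= n)%N ->
      u n = mulop (f ^+ (n - t)) * \sum_(i < t.+1) (binomial_poly j i).[n%:R] *: A i.
Proof.
move=> fe jt [d [d' [Bd Bd' ->]]].
have hd := bernstein_bounded (isT : 2 <= 2 :> int) Bd.
have hd' := bernstein_bounded (isT : 2 <= 2 :> int) Bd'.
exists (fun i => mulop (f ^+ (t + j - i)) * iter i (fbracket f) d * d'); split=> [i|n tn].
  have it : (i <= t)%N by rewrite -ltnS.
  have h0 : deg_le ((t + j - i) * e) (f ^+ (t + j - i)) by exact: deg_leX.
  have h1 := bounded_op_mulop h0.
  apply: bounded_opW (bounded_opM (bounded_opM h1 (fbracket_bounded fe hd it)) hd').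
    by lia.
  by nia.
rewrite mulop_pow_right.
pose F i := ('C(n + j, i)%:R : K) *: (mulop (f ^+ (n + j - i)) * iter i (fbracket f) d).
have -> : \sum_(i < (n + j).+1) F i = \sum_(i < t.+1) F i.
  have le : (t < (n + j).+1)%N by rewrite ltnS (leq_trans tn) ?leq_addr.
  rewrite [RHS](big_ord_widen _ F le) [RHS]big_mkcond /=.
  apply: eq_bigr => i _; case: ltnP => // ti.
  by rewrite /F (fbracket_eq0 f hd ti) mulr0 scaler0.
rewrite mulr_suml mulr_sumr; apply: eq_bigr => i _.
rewrite binomial_polyE /F -scalerAr -scalerAl; congr (_ *: _).
rewrite !mulrA -rmorphM -exprD; congr (mulop (f ^+ _) * _ * _).
have := ltn_ord i; lia.
Qed.

Lemma mcoeff_segre_sum (T : Type) (r : seq T) (P : pred T) (F : T -> R) m :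
  mcoeff m (segre_val (\sum_(i <- r | P i) F i)) =
  \sum_(i <- r | P i) mcoeff m (segre_val (F i)).
Proof. by rewrite segre_val_sum raddf_sum. Qed.

(** Once the power of [f] is split off, an operator of order at most [2 * t] remains. By
    [diff_le_eq0] its values on monomials of degree at most [2 * t] determine it, and the number of
    their coefficients is below the cardinality of [J]. *)
Lemma layers_dependent f e t (J : finType) (lev : J -> nat) (v : J -> opseq R) :
  deg_le e f -> (forall y, (lev y <= t)%N) ->
  (forall y, sandwich_layer f (lev y) t (v y)) ->
  ((2 * t).+1 ^ (a + b).+1 * (4 * t + 2 * t * e).+1 ^ (a + b).+1 < #|J|)%N ->
  exists2 c : J -> {poly K}, exists y, c y != 0 & \sum_y c y *: v y = 0.
Proof.
move=> fe levt layer ltJ.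
have /choice[A AP] y := layer_normal_form fe (levt y) (layer y).
pose X := (2 * t + (2 * t + 2 * t * e)).+1; pose Y := (2 * t).+1.
pose co (d : D) (g : {ffun Z -> 'I_Y}) (h : {ffun Z -> 'I_X}) : K :=
  mcoeff (decode_mnm h) (segre_val (d (smon K (decode_mnm g)))).
have [|c [y0 cy0] cE] := @left_kernel {poly K} J ({ffun Z -> 'I_Y} * {ffun Z -> 'I_X})%type
    (fun y gh => \sum_(i < t.+1) co (A y i) gh.1 gh.2 *: binomial_poly (lev y) i).
  rewrite card_prod !card_ffun card_sum !card_ord addSn; apply: leq_ltn_trans ltJ.
  by rewrite leq_mul2l leq_exp2r // /X ltnS; apply/orP; right; lia.
exists (fun y => root_poly K t * c y).
  by exists y0; rewrite mulf_neq0 ?root_poly_neq0.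
apply/funext => n; rewrite opseq_sum opseq0.
under eq_bigr do rewrite opseqZ hornerM -scalerA.
rewrite -scaler_sumr; have [nt|tn] := ltnP n t; first by rewrite root_poly_eq0 // scale0r.
pose E := \sum_y (c y).[n%:R] *: \sum_(i < t.+1) (binomial_poly (lev y) i).[n%:R] *: A y i.
have -> : \sum_y (c y).[n%:R] *: v y n = mulop (f ^+ (n - t)) * E.
  rewrite /E mulr_sumr; apply: eq_bigr => y _; rewrite -scalerAr; congr (_ *: _).
  exact: (AP y).2.
have bE : bounded_op (2 * t) (2 * t + 2 * t * e) E.
  apply: bounded_op_sum => y _; rewrite -[_ *: _]addr0.
  apply: bounded_op_comb; last exact: bounded_op0.
  apply: bounded_op_sum => i _; rewrite -[_ *: _]addr0.
  by apply: bounded_op_comb; [exact: (AP y).1|exact: bounded_op0].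
suff -> : E = 0 by rewrite mulr0 scaler0.
apply: (diff_le_eq0 bE.1) => m bm mt.
have [g gm] := decode_mnm_onto bm (mt : (xdeg m < Y)%N).
apply: (coordinates_eq0 (N := X) (bE.2 m bm)); first by rewrite /X ltnS leq_add2r.
move=> h; have := congr1 (fun p : {poly K} => p.[n%:R]) (cE (g, h)).
rewrite /= horner0 => <-; rewrite horner_sum /E diffop_sum mcoeff_segre_sum.
apply: eq_bigr => y _; rewrite diffopZ segre_valZ mcoeffZ hornerM; congr (_ * _).
rewrite horner_sum diffop_sum mcoeff_segre_sum; apply: eq_bigr => i _.
by rewrite diffopZ segre_valZ mcoeffZ [RHS]hornerZ mulrC /co gm.
Qed.

(* Otherwise the [L] layers [D(s) f^(s+j) D(s)] would all be strictly decreasing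
   and contribute [L q^(2n)] independent elements to a space of rank
   [O(q^(2n))], with a constant not depending on [L]. *)
Lemma sandwich_bs_neq0 f : sandwich_bs f != 0.
Proof.
apply/eqP => bs0; have [e fe] := deg_le_exists f.
set n := (a + b).+1; pose C := (zc + sc)%N.
have C0 : (0 < C)%N by rewrite /C /separation_cost; nia.
(* With [q = L] and [t = C * L] the rank bound is at most a constant times [L ^ (2 * n)]; [L] is
   chosen to exceed that constant. *)
pose L := (((2 * C).+1 * (4 * C + 2 * C * e).+1) ^ n).+1; pose t := (C * L)%N.
have Lt : (L <= t)%N by rewrite /t leq_pmull.
have /choice[v vP] (j : 'I_L) := sandwich_layer_free L (opow_notin (j := j) bs0).
pose Q := (L ^ n * L ^ n)%N.
have [| | |c [[j1 i1] cji] cE] := @layers_dependent f e t ('I_L * 'I_Q)%type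
  (fun y => y.1) (fun y => v y.1 y.2) fe.
- by move=> y; apply: leq_trans Lt; exact: ltnW.
- by move=> y; exact: (vP y.1).1.
- rewrite card_prod !card_ord -/n /Q.
  apply: (@leq_ltn_trans (((2 * C).+1 * L) ^ n * ((4 * C + 2 * C * e).+1 * L) ^ n)%N).
    have L1 : (1 <= L)%N by [].
    apply: leq_mul; rewrite leq_exp2r // /t mulSn; nia.
  rewrite !expnMn mulnACA -expnMn ltn_pmul2r //.
  by rewrite muln_gt0 !expn_gt0.
(* In the first layer [j] with a nonzero coefficient, the relation contradicts freeness modulo
   [sandwich_module f j.+1], which contains all later layers. *)
pose has_coeff (j : 'I_L) := [exists i, c (j, i) != 0].
have hj1 : has_coeff j1 by apply/existsP; exists i1.
case: (arg_minnP (fun j : 'I_L => nat_of_ord j) hj1) => j /existsP[i cij] minj.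
have sat := sandwich_module_saturated f j.+1.
have /eqP[] := cij; have [_ fv] := vP j; apply: (fv (fun i => c (j, i))).
have cE' : \sum_j \sum_i c (j, i) *: v j i = 0.
  by rewrite pair_bigA /= -[RHS]cE; apply: eq_bigr => -[].
move: cE'; rewrite (bigD1 j) //= => /eqP; rewrite addr_eq0 => /eqP ->;
  rewrite -scaleN1r -[_ *: _]addr0.
case: (sat) => N0 ND _; apply: (ND) => //.
rewrite -[X in sandwich_module _ _ X]scale1r scaler_sumr; apply: saturated_sum => // k kj.
have [lt|ge] := ltnP k j.
  rewrite big1 // => i' _; have [->|nz] := eqVneq (c (k, i')) 0; first by rewrite scale0r.
  have : has_coeff k by apply/existsP; exists i'.
  by move=> /minj; rewrite leqNgt lt.
apply: saturated_sum => // i' _; apply: (@sandwich_moduleW _ _ f j.+1 k).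
  by rewrite ltn_neqAle ge andbT eq_sym; apply: contraNneq kj => h; apply/eqP/val_inj.
exact: layer_sandwich_module ((vP k).1 i').
Qed.

End SandwichGrowth.

Theorem theorem7p3 (Re : realType) (a b : nat) (ha : (1 < a)%N) (hb : (1 < b)%N) :
  [/\ forall B : nat -> set (diffop (segre Re[i] a b)),
        bernstein_filtration (@segre_grading Re[i] a b) B ->
        linearly_simple B,
      forall (B : nat -> set (diffop (segre Re[i] a b)))
             (M : lmodType (diffop (segre Re[i] a b))) (F : nat -> set M),
        bernstein_filtration (@segre_grading Re[i] a b) B ->
        (exists m : M, m != 0) ->
        compatible_filtration B F ->
        (krull_dim Re (segre Re[i] a b) <= Dim Re F)%E
    & forall f : segre Re[i] a b, f != 0 -> sandwich_bs f != 0].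
Proof.
case: a ha hb => [//|a'] _; case: b => [//|b'] _; split.
- by move=> B [w /bernstein_slope_ge2 w2 ->]; exact: bernstein_linearly_simple.
- move=> B M F [w /bernstein_slope_ge2 w2 ->] M0 cF.
  by apply: le_trans (krull_dim_segre _ _ _ _) (Dim_ge w2 _ M0 cF).
- by move=> f _; exact: sandwich_bs_neq0.
Qed.
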